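(* Let $a_1,b_1,a_2,b_2,a_3,b_3$ be real numbers with $0\le a_i<b_i$ for $i=1,2,3$ and $$a_1b_2b_3+b_1a_2a_3 \;\le\; b_1a_2b_3+a_1b_2a_3 \;\le\; b_1b_2a_3+a_1a_2b_3 .$$ Let $\mathcal{P}_2\subset\mathbb{R}^4$ be the double-McCormick relaxation obtained by first grouping $x_1$ and $x_3$, let $\mathcal{P}_H\subset\mathbb{R}^4$ be the trilinear hull, and let $v^1,\dots,v^8,v_2^9,\dots,v_2^{12}\in\mathbb{R}^4$ be the points defined in the context. Then the set of extreme points of $\mathcal{P}_2$ is $\{v^1,\ldots,v^8\}\cup\{v_2^9,v_2^{10},v_2^{11},v_2^{12}\}$. Moreover, $$\operatorname{Vol}(\mathcal{P}_2)=\operatorname{Vol}(\mathcal{P}_H)+\frac{(b_1-a_1)(b_2-a_2)^2(b_3-a_3)^2\big(5(a_1b_1b_3-a_1b_1a_3)+3(b_1^2a_3-a_1^2b_3)\big)}{24(b_1b_3-a_1a_3)}.$$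
   Context: Points of $\mathbb{R}^4$ are written with coordinates $(f,x_1,x_2,x_3)$; $\operatorname{Vol}$ is 4-dimensional Lebesgue measure. Trilinear hull: $\mathcal{P}_H$ is the convex hull of the eight points $(x_1x_2x_3,x_1,x_2,x_3)$ with $x_i\in\{a_i,b_i\}$, $i=1,2,3$. Double-McCormick relaxation: $\mathcal{P}_2$ is the set of all $(f,x_1,x_2,x_3)\in\mathbb{R}^4$ for which there exists $w\in\mathbb{R}$ satisfying the McCormick inequalities for $w=x_1x_3$, $$w-a_3x_1-a_1x_3+a_1a_3\ge0,\quad -w+b_3x_1+a_1x_3-a_1b_3\ge0,\quad -w+a_3x_1+b_1x_3-b_1a_3\ge0,\quad w-b_3x_1-b_1x_3+b_1b_3\ge0,$$ and the McCormick inequalities for $f=wx_2$ with $w\in[a_1a_3,b_1b_3]$, $$f-a_2w-a_1a_3x_2+a_1a_2a_3\ge0,\quad -f+b_2w+a_1a_3x_2-a_1b_2a_3\ge0,\quad -f+a_2w+b_1b_3x_2-b_1a_2b_3\ge0,\quad f-b_2w-b_1b_3x_2+b_1b_2b_3\ge0.$$ Points: $v^1=(b_1a_2a_3,b_1,a_2,a_3)$, $v^2=(a_1a_2a_3,a_1,a_2,a_3)$, $v^3=(a_1a_2b_3,a_1,a_2,b_3)$, $v^4=(a_1b_2a_3,a_1,b_2,a_3)$, $v^5=(a_1b_2b_3,a_1,b_2,b_3)$, $v^6=(b_1b_2b_3,b_1,b_2,b_3)$, $v^7=(b_1b_2a_3,b_1,b_2,a_3)$, $v^8=(b_1a_2b_3,b_1,a_2,b_3)$,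 and $$v_2^9=(\theta^1,b_1,\theta^2,a_3),\quad v_2^{10}=(\theta^3,a_1,\theta^4,b_3),\quad v_2^{11}=(\theta^5,a_1,\theta^6,b_3),\quad v_2^{12}=(\theta^7,b_1,\theta^8,a_3),$$ where, with $D=b_1b_3-a_1a_3$, $$\theta^1=a_1a_2a_3+\tfrac{a_3(b_1-a_1)(b_1b_2b_3-a_1a_2a_3)}{D},\quad \theta^2=a_2+\tfrac{a_3(b_2-a_2)(b_1-a_1)}{D},$$ $$\theta^3=a_1a_2a_3+\tfrac{a_1(b_3-a_3)(b_1b_2b_3-a_1a_2a_3)}{D},\quad \theta^4=a_2+\tfrac{a_1(b_3-a_3)(b_2-a_2)}{D},$$ $$\theta^5=\tfrac{b_3a_1(a_2b_3b_1-a_2a_3b_1-b_2a_3a_1+b_2a_3b_1)}{D},\quad \theta^6=a_2+\tfrac{b_3(b_2-a_2)(b_1-a_1)}{D},$$ $$\theta^7=\tfrac{a_3b_1(b_2b_3a_1-b_2a_3a_1-a_2b_3a_1+a_2b_3b_1)}{D},\quad \theta^8=a_2+\tfrac{b_1(b_3-a_3)(b_2-a_2)}{D}.$$ (When some $a_i=0$ some of the listed points may coincide; the statement concerns the set of points.) *)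

(* Defs.v *)
From mathcomp Require Import all_boot all_order all_algebra.
From mathcomp Require Import all_classical all_reals all_analysis.
Import Order.TTheory GRing.Theory Num.Theory numFieldNormedType.Exports.

Set Implicit Arguments.
Unset Strict Implicit.
Unset Printing Implicit Defensive.

Local Open Scope classical_set_scope.
Local Open Scope ring_scope.

Section Convexity.
Context {R : realType} {E : lmodType R}.

(* The smallest convex set containing S. *)
Definition convex_hull (S : set E) : set E :=
  \bigcap_(C in [set C : set E | convex_set C /\ S `<=` C]) C.

Definition extreme_points (A : set E) : set E :=
  [set x | A x /\ forall (y z : E) (t : R), A y -> A z -> 0 < t -> t < 1 ->
    x = t *: y + (1 - t) *: z -> y = x /\ z = x].

End Convexity.

(* R^4; a point is written (f, x1, x2, x3). *)
Definition R4 (R : realType) : lmodType R := (R * R * R * R)%type.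

(* The iterated product measure is defined on every set of points; on the Borel
   sets (in particular on polytopes) it is 4-dimensional Lebesgue measure. *)
Definition vol4 {R : realType} (A : set (R4 R)) : \bar R :=
  (((@lebesgue_measure R \x @lebesgue_measure R)
     \x @lebesgue_measure R) \x @lebesgue_measure R)%E A.

(* The McCormick inequalities for w = x * y with x in [lx, ux], y in [ly, uy]. *)
Definition mccormick {R : realType} (lx ux ly uy w x y : R) : Prop :=
  [/\ 0 <= w - ly * x - lx * y + lx * ly,
      0 <= - w + uy * x + lx * y - lx * uy,
      0 <= - w + ly * x + ux * y - ux * ly &
      0 <= w - uy * x - ux * y + ux * uy].

Section Trilinear.
Context {R : realType}.
Variables a1 b1 a2 b2 a3 b3 : R.

Definition trilinear_hull : set (R4 R) :=
  convex_hull [set p : R4 R | exists x1 x2 x3 : R,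
    [/\ [set a1; b1] x1, [set a2; b2] x2, [set a3; b3] x3 &
        p = (x1 * x2 * x3, x1, x2, x3)]].

(* Grouping x1 and x3 first: w = x1 x3, then f = w x2 with w in [a1 a3, b1 b3]. *)
Definition double_mccormick2 : set (R4 R) :=
  [set p : R4 R | let: (f, x1, x2, x3) := p in exists w : R,
    mccormick a1 b1 a3 b3 w x1 x3 /\
    mccormick (a1 * a3) (b1 * b3) a2 b2 f w x2].

Definition v1 : R4 R := (b1 * a2 * a3, b1, a2, a3).
Definition v2 : R4 R := (a1 * a2 * a3, a1, a2, a3).
Definition v3 : R4 R := (a1 * a2 * b3, a1, a2, b3).
Definition v4 : R4 R := (a1 * b2 * a3, a1, b2, a3).
Definition v5 : R4 R := (a1 * b2 * b3, a1, b2, b3).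
Definition v6 : R4 R := (b1 * b2 * b3, b1, b2, b3).
Definition v7 : R4 R := (b1 * b2 * a3, b1, b2, a3).
Definition v8 : R4 R := (b1 * a2 * b3, b1, a2, b3).

Let D : R := b1 * b3 - a1 * a3.

Definition theta1 : R :=
  a1 * a2 * a3 + a3 * (b1 - a1) * (b1 * b2 * b3 - a1 * a2 * a3) / D.
Definition theta2 : R := a2 + a3 * (b2 - a2) * (b1 - a1) / D.
Definition theta3 : R :=
  a1 * a2 * a3 + a1 * (b3 - a3) * (b1 * b2 * b3 - a1 * a2 * a3) / D.
Definition theta4 : R := a2 + a1 * (b3 - a3) * (b2 - a2) / D.
Definition theta5 : R :=
  b3 * a1 * (a2 * b3 * b1 - a2 * a3 * b1 - b2 * a3 * a1 + b2 * a3 * b1) / D.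
Definition theta6 : R := a2 + b3 * (b2 - a2) * (b1 - a1) / D.
Definition theta7 : R :=
  a3 * b1 * (b2 * b3 * a1 - b2 * a3 * a1 - a2 * b3 * a1 + a2 * b3 * b1) / D.
Definition theta8 : R := a2 + b1 * (b3 - a3) * (b2 - a2) / D.

Definition v2_9 : R4 R := (theta1, b1, theta2, a3).
Definition v2_10 : R4 R := (theta3, a1, theta4, b3).
Definition v2_11 : R4 R := (theta5, a1, theta6, b3).
Definition v2_12 : R4 R := (theta7, b1, theta8, a3).

End Trilinear.

(* Main.v *)
Require Import Defs.
From HB Require Import structures.
From mathcomp Require Import all_boot all_order all_algebra.
From mathcomp Require Import all_classical all_reals all_analysis.
From mathcomp Require Import measurable_realfun ring lra.
Import Order.TTheory GRing.Theory Num.Theory numFieldNormedType.Exports.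

(* With x_i = a_i + (b_i - a_i) t_i, both polytopes have the form
   {t in [0,1]^3, L t <= f <= U t} for explicit piecewise linear L and U.
   The relaxation is bounded by the McCormick functions of f = w x2 evaluated
   at the least and the greatest admissible w, since these are nondecreasing
   in w.  For the hull, U is the Lovasz extension of x1 x2 x3, which is affine on
   the six simplices of the Kuhn triangulation, and L is affine on the two
   corner simplices at 0 and (1,1,1) and on the four simplices around the
   diagonal from (1,0,0) to (0,1,1) of the remaining octahedron; the two ordering
   hypotheses say a1/b1 <= a2/b2 <= a3/b3, which selects that diagonal.
   Both (L t, t) and (U t, t) are explicit convex combinations of the vertices,
   and the volumes are iterated integrals of U - L, where the positive part
   makes all antiderivatives explicit. *)

Set Implicit Arguments.
Unset Strict Implicit.
Unset Printing Implicit Defensive.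

Local Open Scope classical_set_scope.
Local Open Scope ring_scope.

(** * Convex sets and extreme points *)

(** The pivot for each polytope is one statement: every convex set containing the listed points
    contains both bounding graphs. Quantified over all convex sets, it puts the slab inside the hull
    of these points, and hence leaves no room for further extreme points: deleting an extreme point
    from a convex set keeps it convex. Applied to the slab itself, it yields L <= U without
    comparing formulas. No compactness is involved.

    The variable t2 plays a special role. At fixed t1 and t3 all functions are piecewise affine in
    t2, with breaks that depend piecewise affinely on t1 and t3. Integrating t2 first therefore
    leaves, in both cases, a function that is quadratic on each of the four triangles cut from the
    (t1, t3) square by its diagonals, and one formula serves both volumes. The breaks also explain
    the points numbered 9 to 12: they are the breaks of L and U on those edges of the cube parallel
    to the t2 axis where the normalized product x1 x3 need not be 0 or 1. *)

Section ConvexSets.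
Context {R : realType} {E : lmodType R}.
Implicit Types (C A : set E) (x y z : E).

Lemma convex_setP C : convex_set C <->
  forall x y (t : R), 0 <= t <= 1 -> C x -> C y -> C (t *: x + (1 - t) *: y).
Proof.
split=> [cC x y t t01 Cx Cy | cC x y l /set_mem Cx /set_mem Cy].
  have := cC x y (Itv01 (andP t01).1 (andP t01).2) (mem_set Cx) (mem_set Cy).
  by move/set_mem.
by apply/mem_set/cC => //; apply/andP.
Qed.

(* [C] is homogenized to the cone over [{1} * C], which is closed under sums. *)
Let cone C (w : R) x := w = 0 /\ x = 0 \/ 0 < w /\ C (w^-1 *: x).

Let coneZ C w x : 0 <= w -> C x -> cone C w (w *: x).
Proof.
rewrite le_eqVlt => /orP[/eqP<-|w0] Cx; first by left; rewrite scale0r.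
by right; split => //; rewrite scalerA mulVf ?scale1r// gt_eqF.
Qed.

Let coneD C w x v y : convex_set C ->
  cone C w x -> cone C v y -> cone C (w + v) (x + y).
Proof.
move=> /convex_setP cC [[-> ->]|[w0 Cx]]; first by rewrite !add0r.
case=> [[-> ->]|[v0 Cy]]; first by rewrite !addr0; right.
have wv0 : 0 < w + v by rewrite addr_gt0.
right; split => //.
have /cC : 0 <= w / (w + v) <= 1.
  apply/andP; split; first by rewrite divr_ge0 ?ltW.
  by rewrite ler_pdivrMr// mul1r lerDl ltW.
move=> /(_ _ _ Cx Cy); congr (C _).
rewrite !scalerA scalerDr; congr (_ *: _ + _ *: _); field.
  by rewrite !gt_eqF.
by rewrite !gt_eqF.
Qed.

(** Iterated binary combinations would divide by partial sums of the weights, which may vanish. In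
    the cone a zero weight contributes the apex, and only the total weight 1 is divided out. Four
    points are what a simplex over the three-dimensional box requires. *)
Lemma convex_set_comb4 C x y z u (a b c d : R) : convex_set C ->
  C x -> C y -> C z -> C u -> 0 <= a -> 0 <= b -> 0 <= c -> 0 <= d ->
  a + b + c + d = 1 -> C (a *: x + b *: y + c *: z + d *: u).
Proof.
move=> cC Cx Cy Cz Cu a0 b0 c0 d0 abcd.
have := coneD cC (coneD cC (coneD cC (coneZ a0 Cx) (coneZ b0 Cy))
  (coneZ c0 Cz)) (coneZ d0 Cu).
rewrite abcd => -[[/eqP]|[_]]; first by rewrite oner_eq0.
by rewrite invr1 scale1r.
Qed.

(** The affine curve [phi] covers two uses: vertical segments, where only f moves, and segments
    along which t2 moves and f follows affinely. The interval may be a single point. *)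
Lemma convex_set_segment C (phi : R -> E) (u v z : R) : convex_set C ->
  (forall t, phi (t * u + (1 - t) * v) = t *: phi u + (1 - t) *: phi v) ->
  u <= z <= v -> C (phi u) -> C (phi v) -> C (phi z).
Proof.
move=> /convex_setP cC phiE /andP[uz zv] Cu Cv.
have [uv|] := ltP u v; last first.
  move=> vu; have -> // : z = u.
  by apply/le_anti/andP; split=> //; exact: le_trans vu.
have vu0 : 0 < v - u by rewrite subr_gt0.
have := cC _ _ ((v - z) / (v - u)) _ Cu Cv; rewrite -phiE.
have -> : (v - z) / (v - u) * u + (1 - (v - z) / (v - u)) * v = z.
  by field; rewrite gt_eqF.
apply; apply/andP; split; first by rewrite divr_ge0 ?subr_ge0// ltW.
by rewrite ler_pdivrMr// mul1r lerD2l lerN2.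
Qed.

(** A combination of two other points of [A] that hits [x] would have to be proper, and extremality
    would then identify its ends with [x]. *)
Lemma convex_setD_extreme A x : convex_set A -> extreme_points A x ->
  convex_set (A `\ x).
Proof.
move=> /convex_setP cA [Ax ext]; apply/convex_setP => y z t t01 [Ay yx] [Az zx].
split; first exact: cA.
case/andP: t01; rewrite le_eqVlt => /orP[/eqP<-|t0].
  by rewrite scale0r subr0 scale1r add0r.
rewrite le_eqVlt => /orP[/eqP->|t1].
  by rewrite scale1r subrr scale0r addr0.
by move=> /esym /(ext _ _ _ Ay Az t0 t1) [/yx].
Qed.

(** The second hypothesis says that [A] lies in the convex hull of [V]. If an extreme point [x] were
    missing from [V], then [A] without [x] would be a convex set containing [V], hence all of
    [A]. *)
Lemma extreme_points_subset A V : convex_set A ->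
  (forall C, convex_set C -> V `<=` C -> A `<=` C) -> V `<=` A ->
  extreme_points A `<=` V.
Proof.
move=> cA AV VA x xA; apply: contrapT => Vx.
have Axx : ~ (A `\ x) x by move=> [_]; apply.
apply/Axx/(AV _ (convex_setD_extreme cA xA)) => [y Vy|]; last exact: xA.1.
by split; [exact: VA|move=> yx; apply: Vx; rewrite -yx].
Qed.

End ConvexSets.

(** * Positive parts and their iterated integrals *)

Section Posp.
Context {R : realType}.
Implicit Types x t c : R.

Definition posp x : R := Num.max x 0.

Variant posp_spec x : R -> Type :=
  | PospNonneg of 0 <= x : posp_spec x x
  | PospNonpos of x <= 0 : posp_spec x 0.

Lemma pospP x : posp_spec x (posp x).
Proof.
by rewrite /posp; case: leP => [x0|/ltW x0]; [apply: PospNonpos | apply: PospNonneg].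
Qed.

Lemma posp_ge0 x : 0 <= posp x. Proof. by case: pospP. Qed.

Lemma posp_ge x : x <= posp x. Proof. by case: pospP. Qed.

Lemma continuous_posp : continuous posp.
Proof.
have -> : posp = fun x => (x + `|x|) / 2.
  apply/funext => x; case: pospP => x0; first by rewrite ger0_norm//; lra.
  by rewrite ler0_norm// subrr mul0r.
move=> x; apply: cvgMl; apply: cvgD; first exact: cvg_id.
exact: norm_continuous.
Qed.

Lemma continuous_pospX n : continuous (fun x => posp x ^+ n).
Proof.
move=> x; apply: (@continuous_comp _ _ _ posp (fun y => y ^+ n)).
  exact: continuous_posp.
exact: exprn_continuous.
Qed.

Lemma is_derive_exprn n x : is_derive x 1 (fun t => t ^+ n) (n%:R * x ^+ n.-1).
Proof.
apply: DeriveDef; first exact: exprn_derivable.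
by rewrite exp_derive /GRing.scale/= mulr1.
Qed.

(** Exponents from 2 on smooth the kink: at 0 the difference quotient is again a positive power of
    [posp], which tends to 0. *)
Lemma is_derive_pospX n x :
  is_derive x 1 (fun t => posp t ^+ n.+2) (n.+2%:R * posp x ^+ n.+1).
Proof.
have [x0|x0|->] := ltgtP x 0.
- have -> : posp x = 0 by apply/max_idPr/ltW.
  rewrite expr0n mulr0; apply: (@near_eq_is_derive _ _ _ (cst 0)).
  near=> t; rewrite /posp (_ : Num.max t 0 = 0) ?expr0n//; apply/max_idPr.
  by near: t; exact: lt_le_nbhsl.
- have -> : posp x = x by apply/max_idPl/ltW.
  apply: (@near_eq_is_derive _ _ _ (fun t => t ^+ n.+2)).
    near=> t; rewrite /posp (_ : Num.max t 0 = t)//; apply/max_idPl.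
    by near: t; exact: lt_le_nbhsr.
  exact: is_derive_exprn.
have posp0 : posp 0 = 0 by rewrite /posp maxxx.
suff : (fun h => h^-1 *: (((fun t => posp t ^+ n.+2) \o shift 0) (h *: 1)
    - posp 0 ^+ n.+2)) @ 0^' --> (0 : R).
  move=> d0; rewrite posp0 expr0n mulr0.
  apply: DeriveDef; [by apply/cvg_ex; exists 0|exact: cvg_lim d0].
have : (fun h => posp h ^+ n.+1) @ 0^' --> (0 : R).
  have := @continuous_pospX n.+1 0; rewrite /continuous_at posp0 expr0n.
  exact: cvg_within_filter.
apply: cvg_trans; apply: near_eq_cvg; near=> h.
rewrite /= posp0 expr0n subr0 addr0.
rewrite [_ *: 1]mulr1 /GRing.scale/=.
have h0 : h != 0 by near: h; exact: nbhs_dnbhs_neq.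
case: pospP => _; last by rewrite !expr0n mulr0.
by rewrite (exprS h n.+1) mulKf.
Unshelve. all: by end_near. Qed.

Lemma le0_posp x : x <= 0 -> posp x = 0.
Proof. by move=> ?; apply/max_idPr. Qed.

Lemma ge0_posp x : 0 <= x -> posp x = x.
Proof. by move=> ?; apply/max_idPl. Qed.

(** Reduces the minima in the upper bounds to positive parts, whose powers have explicit
    antiderivatives. *)
Lemma min_posp x y : Num.min x y = x - posp (x - y).
Proof. by rewrite /posp /Num.min /Num.max subr_lt0; case: ltP => _; ring. Qed.

Lemma posp_convex t x y : 0 <= t <= 1 ->
  posp (t * x + (1 - t) * y) <= t * posp x + (1 - t) * posp y.
Proof.
move=> /andP[t0 t1]; have s0 : 0 <= 1 - t by rewrite subr_ge0.
have := ler_wpM2l t0 (posp_ge x); have := ler_wpM2l s0 (posp_ge y).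
have := mulr_ge0 t0 (posp_ge0 x); have := mulr_ge0 s0 (posp_ge0 y).
by case: (pospP (t * x + _)) => _; lra.
Qed.

Lemma min_concave t x y x' y' : 0 <= t <= 1 ->
  t * Num.min x y + (1 - t) * Num.min x' y' <=
  Num.min (t * x + (1 - t) * x') (t * y + (1 - t) * y').
Proof.
move=> /andP[t0 t1]; have s0 : 0 <= 1 - t by rewrite subr_ge0.
by rewrite le_min !lerD// ler_wpM2l// ge_min lexx ?orbT.
Qed.

Lemma measurable_posp d (T : measurableType d) (f : T -> R) :
  measurable_fun setT f -> measurable_fun setT (fun u => posp (f u)).
Proof. by move=> mf; apply: measurable_maxr => //; exact: measurable_cst. Qed.

End Posp.

(** * Integrals over the unit interval certified by antiderivatives *)

Section Integral01.
Context {R : realType}.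
Implicit Types (g : R -> R) (a b c u v : R).

(** A certificate for the fundamental theorem of calculus: [g'] is the derivative of [G], not of
    [g], and has to agree with [g] only on the unit interval. Such certificates add and scale
    without integrability side conditions. *)
Definition integral01 g v := exists G g' : R -> R, [/\ continuous g',
  forall t : R, is_derive t 1 G (g' t),
  forall t, 0 <= t <= 1 -> g t = g' t & G 1 - G 0 = v].

(** The substitution is carried out on the antiderivative: the factor [b - a] in [F] cancels the
    inner derivative, so the fundamental theorem applies on the original interval. The integrand [h]
    is extended-real valued so that it may itself be an inner integral. *)
Lemma integral_rescale g v h a b : integral01 g v -> a < b ->
  (forall x, a <= x <= b -> h x = (g ((x - a) / (b - a)))%:E) ->
  (\int[lebesgue_measure]_(x in `[a, b]) h x = ((b - a) * v)%:E)%E.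
Proof.
move=> [G [g' [cg' G' gg' <-]]] ab hE.
have ba0 : 0 < b - a by rewrite subr_gt0.
pose F x := (b - a) * G ((x - a) / (b - a)).
have F' (x : R) : is_derive x 1 F (g' ((x - a) / (b - a))).
  have aff : is_derive x 1 (fun x : R => (x - a) / (b - a)) (b - a)^-1.
    by apply: is_derive_eq; rewrite scaler0 add0r subr0 /GRing.scale /= mulr1.
  have := @is_derive1_comp R G _ x _ _ (G' _) aff.
  move=> ?; apply: is_derive_eq; rewrite /GRing.scale/=; field.
  by rewrite gt_eqF.
have cF : continuous F.
  by move=> x; apply/differentiable_continuous/derivable1_diffP; case: (F' x).
transitivity (\int[lebesgue_measure]_(x in `[a, b])
    (g' ((x - a) / (b - a)))%:E)%E.
  apply: eq_integral => x; rewrite inE/= in_itv/= => xab; rewrite hE//.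
  case/andP: xab => ax xb; congr EFin; apply: gg'; apply/andP; split.
    by rewrite divr_ge0 ?subr_ge0// ltW.
  by rewrite ler_pdivrMr// mul1r lerD2r.
rewrite (@continuous_FTC2 _ _ F)//.
- by rewrite /F subrr mul0r divff ?gt_eqF// -EFinB -mulrBr.
- apply: continuous_subspaceT => x;
    apply: (@continuous_comp _ _ _ (fun x => (x - a) / (b - a)) g').
    by apply: cvgMl; apply: cvgB; [exact: cvg_id|exact: cvg_cst].
  exact: cg'.
- split; first by move=> x _; case: (F' x).
  + exact/cvg_at_right_filter/cF.
  + exact/cvg_at_left_filter/cF.
- by move=> x _; rewrite derive1E; case: (F' x).
Qed.

Lemma integral01_eq g h u v : integral01 g u ->
  (forall t, 0 <= t <= 1 -> h t = g t) -> u = v -> integral01 h v.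
Proof.
move=> [G [g' [cg' G' gg' Gv]]] hg <-; exists G, g'; split=> // t t01.
by rewrite hg// gg'.
Qed.

Lemma integral01D g h u v : integral01 g u ->
  integral01 h v -> integral01 (fun t => g t + h t) (u + v).
Proof.
move=> [G [g' [cg' G' gg' <-]]] [H [h' [ch' H' hh' <-]]].
exists (G \+ H), (g' \+ h'); split => /=.
- by move=> x; apply: cvgD; [exact: cg'|exact: ch'].
- by move=> t; apply: is_deriveD.
- by move=> t t01; rewrite gg'// hh'.
- by ring.
Qed.

Lemma integral01Z c g u : integral01 g u ->
  integral01 (fun t => c * g t) (c * u).
Proof.
move=> [G [g' [cg' G' gg' <-]]].
exists (fun t => c * G t), (fun t => c * g' t); split => /=.
- by move=> x; apply: cvgMr; exact: cg'.
- by move=> t; apply: is_deriveZ.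
- by move=> t t01; rewrite gg'.
- by ring.
Qed.

Lemma integral01X n : integral01 (fun t => t ^+ n) (n.+1%:R^-1).
Proof.
exists (fun t => n.+1%:R^-1 * t ^+ n.+1), (fun t => t ^+ n); split => //.
- exact: exprn_continuous.
- move=> t; have ? := is_derive_exprn n.+1 t.
  by apply: is_derive_eq; rewrite /GRing.scale/= mulKf.
- by rewrite expr0n mulr0 subr0 expr1n mulr1.
Qed.

Lemma integral01_pospD n c :
  integral01 (fun t => posp (t + c) ^+ n.+1)
    ((posp (1 + c) ^+ n.+2 - posp c ^+ n.+2) / n.+2%:R).
Proof.
exists (fun t => n.+2%:R^-1 * posp (t + c) ^+ n.+2),
  (fun t => posp (t + c) ^+ n.+1); split => //.
- move=> x; apply: (@continuous_comp _ _ _ (fun t => t + c)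
    (fun y => posp y ^+ n.+1)).
    by apply: cvgD; [exact: cvg_id|exact: cvg_cst].
  exact: continuous_pospX.
- move=> t; have tr : is_derive t 1 (fun t => t + c) 1.
    by apply: is_derive_eq; rewrite addr0.
  have := @is_derive1_comp R _ _ t _ _ (is_derive_pospX n (t + c)) tr.
  move=> ?; apply: is_derive_eq.
  by rewrite mulr1 /GRing.scale/= mulKf.
- by rewrite add0r -mulrBr mulrC.
Qed.

Lemma integral01_pospB n c :
  integral01 (fun t => posp (c - t) ^+ n.+1)
    ((posp c ^+ n.+2 - posp (c - 1) ^+ n.+2) / n.+2%:R).
Proof.
exists (fun t => - n.+2%:R^-1 * posp (c - t) ^+ n.+2),
  (fun t => posp (c - t) ^+ n.+1); split => //.
- move=> x; apply: (@continuous_comp _ _ _ (fun t => c - t)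
    (fun y => posp y ^+ n.+1)).
    by apply: cvgB; [exact: cvg_cst|exact: cvg_id].
  exact: continuous_pospX.
- move=> t; have tr : is_derive t 1 (fun t => c - t) (-1).
    by apply: is_derive_eq; rewrite add0r mul1r.
  have := @is_derive1_comp R _ _ t _ _ (is_derive_pospX n (c - t)) tr.
  move=> ?; apply: is_derive_eq.
  by rewrite /GRing.scale/= mulrN1 mulrNN mulKf.
- by rewrite subr0; field.
Qed.

End Integral01.

(** * Volumes of slabs over a box *)

Section ProductMeasure.
Local Open Scope ereal_scope.
Context {R : realType}.

(** The product measure is built by integrating over its first factor. Slicing along the second one,
    justified by uniqueness of the product measure, makes the last coordinate outermost and leaves
    the fibre in f, the first coordinate, for the end. *)
Lemma product_measure_ysection d1 d2 (T1 : measurableType d1)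
    (T2 : measurableType d2) (m1 : {sigma_finite_measure set T1 -> \bar R})
    (m2 : {sigma_finite_measure set T2 -> \bar R}) (A : set (T1 * T2)) :
  measurable A -> (m1 \x m2) A = \int[m2]_y m1 (ysection A y).
Proof.
move=> mA; rewrite (@product_measure_unique _ _ _ _ _ m1 m2 (m1 \x^ m2))//.
by move=> B C mB mC; exact: product_measure2E.
Qed.

(* The canonical sigma-finite structure of [m1 \x m2] in the library is the one
   for subprobability measures only; this copy of the product measure carries
   the structure for sigma-finite factors. *)
Definition sigma_finite_product d1 d2 (T1 : measurableType d1)
    (T2 : measurableType d2) (m1 : {sigma_finite_measure set T1 -> \bar R})
    (m2 : {sigma_finite_measure set T2 -> \bar R}) : set (T1 * T2) -> \bar R :=
  m1 \x m2.

Section sigma_finite_product.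
Context d1 d2 (T1 : measurableType d1) (T2 : measurableType d2).
Context (m1 : {sigma_finite_measure set T1 -> \bar R}).
Context (m2 : {sigma_finite_measure set T2 -> \bar R}).

HB.instance Definition _ := Measure.on (sigma_finite_product m1 m2).
HB.instance Definition _ := Measure_isSigmaFinite.Build _ _ _
  (sigma_finite_product m1 m2)
  (lebesgue_integral_fubini.product_measure_sigma_finite_subproof m1 m2).

End sigma_finite_product.

Lemma product_measure4_ysection d1 d2 d3 d4 (T1 : measurableType d1)
    (T2 : measurableType d2) (T3 : measurableType d3) (T4 : measurableType d4)
    (m1 : {sigma_finite_measure set T1 -> \bar R})
    (m2 : {sigma_finite_measure set T2 -> \bar R})
    (m3 : {sigma_finite_measure set T3 -> \bar R})
    (m4 : {sigma_finite_measure set T4 -> \bar R})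
    (A : set (T1 * T2 * T3 * T4)) : measurable A ->
  (((m1 \x m2) \x m3) \x m4) A =
    \int[m4]_x4 \int[m3]_x3 \int[m2]_x2 m1 [set x1 | A (x1, x2, x3, x4)].
Proof.
move=> mA.
apply: etrans (product_measure_ysection
  (sigma_finite_product (sigma_finite_product m1 m2) m3) m4 mA) _.
apply: eq_integral => x4 _.
have mA4 := @measurable_ysection _ _ _ _ _ x4 mA.
apply: etrans (product_measure_ysection (sigma_finite_product m1 m2) m3 mA4) _.
apply: eq_integral => x3 _.
have mA3 := @measurable_ysection _ _ _ _ _ x3 mA4.
apply: etrans (product_measure_ysection m1 m2 mA3) _.
by apply: eq_integral => x2 _; rewrite !ysectionE.
Qed.

End ProductMeasure.

(** * The volume of a slab as an iterated integral over the box *)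

Section Volume.
Context {R : realType}.
Variables a1 b1 a2 b2 a3 b3 : R.
Hypotheses (ab1 : a1 < b1) (ab2 : a2 < b2) (ab3 : a3 < b3).
Implicit Types (L U : R -> R -> R -> R) (t x : R).

Definition boxpt (f t1 t2 t3 : R) : R4 R :=
  (f, a1 + (b1 - a1) * t1, a2 + (b2 - a2) * t2, a3 + (b3 - a3) * t3).

Definition slab L U : set (R4 R) := [set p | exists f t1 t2 t3,
  [/\ p = boxpt f t1 t2 t3, 0 <= t1 <= 1, 0 <= t2 <= 1, 0 <= t3 <= 1 &
      L t1 t2 t3 <= f <= U t1 t2 t3]].

Definition measurable_fun3 L := measurable_fun [set: R * R * R]
  (fun q => L q.1.1 q.1.2 q.2).

Let tau a b x := (x - a) / (b - a).

Let measurable_tau a b d (T : measurableType d) (g : T -> R) :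
  measurable_fun setT g -> measurable_fun setT (fun q => tau a b (g q)).
Proof.
move=> mg; apply: measurable_funM; last exact: measurable_cst.
by apply: measurable_funB => //; exact: measurable_cst.
Qed.

Let measurable_fun3_tau L d (T : measurableType d) (g1 g2 g3 : T -> R) :
  measurable_fun3 L -> measurable_fun setT g1 -> measurable_fun setT g2 ->
  measurable_fun setT g3 -> measurable_fun setT (fun q =>
    L (tau a1 b1 (g1 q)) (tau a2 b2 (g2 q)) (tau a3 b3 (g3 q))).
Proof.
move=> mL m1 m2 m3.
apply: (@measurableT_comp _ _ _ _ _ _ (fun q => L q.1.1 q.1.2 q.2) _
  (fun q => (tau a1 b1 (g1 q), tau a2 b2 (g2 q), tau a3 b3 (g3 q)))) => //.
by do 2?apply: measurable_fun_pair; exact: measurable_tau.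
Qed.

Let inbox x1 x2 x3 :=
  [&& a1 <= x1, x1 <= b1, a2 <= x2, x2 <= b2, a3 <= x3 & x3 <= b3].

Let tauP a b x : a < b -> (0 <= tau a b x <= 1) = (a <= x <= b).
Proof.
move=> ab; rewrite /tau ler_pdivrMr ?subr_gt0// mul1r lerD2r.
by rewrite pmulr_lge0 ?invr_gt0 ?subr_gt0// subr_ge0.
Qed.

Let tauK a b x : a < b -> a + (b - a) * tau a b x = x.
Proof. by move=> ab; rewrite /tau; field; rewrite subr_eq0 gt_eqF. Qed.

Let tauE a b t : a < b -> tau a b (a + (b - a) * t) = t.
Proof. by move=> ab; rewrite /tau; field; rewrite subr_eq0 gt_eqF. Qed.

Let slabE L U (f x1 x2 x3 : R) : slab L U (f, x1, x2, x3) <->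
  inbox x1 x2 x3 && (L (tau a1 b1 x1) (tau a2 b2 x2) (tau a3 b3 x3) <= f
    <= U (tau a1 b1 x1) (tau a2 b2 x2) (tau a3 b3 x3)).
Proof.
split.
  move=> [g [t1 [t2 [t3 [[-> -> -> ->] h1 h2 h3 h]]]]].
  rewrite !tauE// h andbT.
  have := tauP (a1 + (b1 - a1) * t1) ab1; have := tauP (a2 + (b2 - a2) * t2) ab2.
  have := tauP (a3 + (b3 - a3) * t3) ab3; rewrite !tauE// h1 h2 h3 /inbox.
  by move=> /esym/andP[-> ->] /esym/andP[-> ->] /esym/andP[-> ->].
move=> /andP[/and5P[h1 h1' h2 h2' /andP[h3 h3']] h].
exists f, (tau a1 b1 x1), (tau a2 b2 x2), (tau a3 b3 x3).
by rewrite /boxpt !tauK// !tauP// h1 h1' h2 h2' h3 h3'.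
Qed.

Lemma slab_boxpt L U f t1 t2 t3 :
  slab L U (boxpt f t1 t2 t3) -> L t1 t2 t3 <= f <= U t1 t2 t3.
Proof. by move=> /slabE/andP[_]; rewrite !tauE. Qed.

Let measurable_slab L U : measurable_fun3 L -> measurable_fun3 U ->
  measurable (slab L U : set (R * R * R * R)).
Proof.
move=> mL mU.
pose h (p : R * R * R * R) := inbox p.1.1.2 p.1.2 p.2 &&
  (L (tau a1 b1 p.1.1.2) (tau a2 b2 p.1.2) (tau a3 b3 p.2) <= p.1.1.1
    <= U (tau a1 b1 p.1.1.2) (tau a2 b2 p.1.2) (tau a3 b3 p.2)).
have -> : slab L U = h @^-1` [set true].
  apply/seteqP; split => -[[[f x1] x2] x3] /=.
    by move/slabE.
  by move=> hp; apply/slabE.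
have mf : measurable_fun [set: R * R * R * R] (fun p => p.1.1.1).
  by do 2!apply: (measurableT_comp measurable_fst).
have m1 : measurable_fun [set: R * R * R * R] (fun p => p.1.1.2).
  apply: (measurableT_comp measurable_snd).
  exact: (measurableT_comp measurable_fst).
have m2 : measurable_fun [set: R * R * R * R] (fun p => p.1.2).
  by apply: (measurableT_comp measurable_snd).
have m3 : measurable_fun [set: R * R * R * R] (fun p => p.2).
  exact: measurable_snd.
have : measurable_fun setT h.
  rewrite /h /inbox; do !apply: measurable_and => //;
    by apply: measurable_fun_ler => //; exact: measurable_fun3_tau.
by move=> /(_ measurableT [set true] I); rewrite setTI.
Qed.

Let mu := @lebesgue_measure R.

Lemma vol4E (A : set (R4 R)) : measurable (A : set (R * R * R * R)) ->
  vol4 A = (\int[mu]_x3 \int[mu]_x2 \int[mu]_x1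
    mu [set f | A (f, x1, x2, x3)])%E.
Proof.
move=> mA; rewrite /vol4.
exact: (product_measure4_ysection mu mu mu mu mA).
Qed.

Let height L U x1 x2 x3 : \bar R := (if inbox x1 x2 x3 then
  U (tau a1 b1 x1) (tau a2 b2 x2) (tau a3 b3 x3) -
  L (tau a1 b1 x1) (tau a2 b2 x2) (tau a3 b3 x3) else 0)%:E.

(** Slicing produces the order x3, x2, x1; Tonelli, applicable because heights are nonnegative,
    exchanges the last two so that x2 is integrated first. *)
Lemma vol4_slabE L U : measurable_fun3 L -> measurable_fun3 U ->
  (forall t1 t2 t3, 0 <= t1 <= 1 -> 0 <= t2 <= 1 -> 0 <= t3 <= 1 ->
    L t1 t2 t3 <= U t1 t2 t3) ->
  vol4 (slab L U) = (\int[mu]_(x3 in `[a3, b3]) \int[mu]_(x1 in `[a1, b1])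
    \int[mu]_(x2 in `[a2, b2])
      (U ((x1 - a1) / (b1 - a1)) ((x2 - a2) / (b2 - a2))
         ((x3 - a3) / (b3 - a3)) -
       L ((x1 - a1) / (b1 - a1)) ((x2 - a2) / (b2 - a2))
         ((x3 - a3) / (b3 - a3)))%:E)%E.
Proof.
move=> mL mU LU.
have mS := measurable_slab mL mU.
have LU' x1 x2 x3 : inbox x1 x2 x3 ->
    L (tau a1 b1 x1) (tau a2 b2 x2) (tau a3 b3 x3) <=
    U (tau a1 b1 x1) (tau a2 b2 x2) (tau a3 b3 x3).
  by move=> /and5P[h1 h1' h2 h2' /andP[h3 h3']]; apply: LU; rewrite tauP//;
    apply/andP.
rewrite (vol4E mS).
rewrite [RHS]integral_mkcond.
apply: eq_integral => x3 _.
(* The fibre in f is the interval from L to U over the box and empty elsewhere; L <= U makes its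
   length U - L even when it is a point. *)
transitivity (\int[mu]_x2 \int[mu]_x1 height L U x1 x2 x3)%E.
  apply: eq_integral => x2 _; apply: eq_integral => x1 _.
  rewrite /height; case: ifPn => box.
    rewrite (_ : [set f | _] = `[L (tau a1 b1 x1) (tau a2 b2 x2) (tau a3 b3 x3),
        U (tau a1 b1 x1) (tau a2 b2 x2) (tau a3 b3 x3)]%classic).
      rewrite /mu lebesgue_measure_itv/= lte_fin -EFinB; case: ltP => // UL.
      by congr EFin; apply/esym/eqP; rewrite subr_eq0 eq_le UL LU'.
    apply/seteqP; split => f /=; rewrite in_itv/=.
      by move=> /slabE; rewrite box.
    by move=> h; apply/slabE; rewrite box.
  transitivity (mu set0); last by rewrite /mu measure0.
  congr (mu _).
  by apply/seteqP; split => f //= /slabE; rewrite (negbTE box).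
have mh : measurable_fun [set: R * R] (fun q => height L U q.1 q.2 x3).
  apply/measurable_EFinP; apply: measurable_fun_ifT.
  - by rewrite /inbox; do !apply: measurable_and => //; apply: measurable_fun_ler.
  - by apply: measurable_funB; exact: measurable_fun3_tau.
  - exact: measurable_cst.
have h_ge0 q : (0 <= height L U q.1 q.2 x3)%E.
  by rewrite /height lee_fin; case: ifPn => // box; rewrite subr_ge0 LU'.
apply: etrans (esym (@fubini_tonelli _ _ _ _ _ mu mu _ mh h_ge0)) _.
rewrite patchE; case: ifPn => [|x3S].
  rewrite inE/= in_itv/= => /andP[ax3 xb3]; rewrite [RHS]integral_mkcond.
  apply: eq_integral => x1 _; rewrite patchE; case: ifPn => [|x1S].
    rewrite inE/= in_itv/= => /andP[ax1 xb1]; rewrite [RHS]integral_mkcond.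
    apply: eq_integral => x2 _; rewrite patchE /height /inbox ax1 xb1 ax3 xb3.
    rewrite /= andbT; case: ifPn => [/andP[ax2 xb2]|x2S].
      by rewrite mem_set//= in_itv/= ax2 xb2.
    by rewrite memNset//= in_itv/=; exact/negP.
  rewrite integral0_eq// => x2 _; rewrite /height /inbox.
  move: x1S; rewrite notin_setE/= in_itv/= => /negP.
  by rewrite andbA => /negbTE ->.
rewrite integral0_eq// => x1 _; rewrite integral0_eq// => x2 _.
move: x3S; rewrite notin_setE/= in_itv/= => /negP.
by rewrite /height /inbox !andbA -andbA => /negbTE ->; rewrite andbF.
Qed.

Lemma vol4_slab L U g h v : measurable_fun3 L -> measurable_fun3 U ->
  (forall t1 t2 t3, 0 <= t1 <= 1 -> 0 <= t2 <= 1 -> 0 <= t3 <= 1 ->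
    L t1 t2 t3 <= U t1 t2 t3) ->
  (forall t1 t3, 0 <= t1 <= 1 -> 0 <= t3 <= 1 ->
    integral01 (fun t2 => U t1 t2 t3 - L t1 t2 t3) (g t1 t3)) ->
  (forall t3, 0 <= t3 <= 1 -> integral01 (fun t1 => g t1 t3) (h t3)) ->
  integral01 h v ->
  vol4 (slab L U) = ((b1 - a1) * (b2 - a2) * (b3 - a3) * v)%:E.
Proof.
move=> mL mU LU ig ih iv; rewrite vol4_slabE//.
have i3 := integral01Z ((b1 - a1) * (b2 - a2)) iv.
rewrite (integral_rescale i3 ab3); first by congr EFin; ring.
move=> x3 x3ab; have t3 : 0 <= tau a3 b3 x3 <= 1 by rewrite tauP.
have i1 := integral01Z (b2 - a2) (ih _ t3).
rewrite (integral_rescale i1 ab1); first by congr EFin; ring.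
move=> x1 x1ab; have t1 : 0 <= tau a1 b1 x1 <= 1 by rewrite tauP.
by rewrite (integral_rescale (ig _ _ t1 t3) ab2).
Qed.

End Volume.

(** * Slabs whose height integrates in t2 to a piecewise quadratic function *)

Section Quad.
Context {R : realType}.
Implicit Types (s t : R).

(** The kinks [s] and [1 - s] lie in the unit interval, so the positive parts vanish at t = 0 and
    become [1 - s] and [s] at t = 1. *)
Lemma integral01_quad_posp s (a b c d e f g : R) : 0 <= s <= 1 ->
  integral01 (fun t => a + b * t + c * t ^+ 2 + d * posp (t - s) +
      e * posp (t - s) ^+ 2 + f * posp (t + s - 1) + g * posp (t + s - 1) ^+ 2)
    (a + b / 2 + c / 3 + d * ((1 - s) ^+ 2 / 2) + e * ((1 - s) ^+ 3 / 3) +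
      f * (s ^+ 2 / 2) + g * (s ^+ 3 / 3)).
Proof.
move=> /andP[s0 s1].
have pospX1 n t : t <= 0 -> posp t ^+ n.+1 = 0.
  by move=> t0; rewrite le0_posp// expr0n.
apply: integral01_eq (integral01D (integral01D (integral01D (integral01D
  (integral01D (integral01D (integral01Z a (integral01X 0))
  (integral01Z b (integral01X 1))) (integral01Z c (integral01X 2)))
  (integral01Z d (integral01_pospD 0 (- s))))
  (integral01Z e (integral01_pospD 1 (- s))))
  (integral01Z f (integral01_pospD 0 (s - 1))))
  (integral01Z g (integral01_pospD 1 (s - 1)))) _ _.
  by move=> t _; rewrite !addrA !expr1 expr0 mulr1.
rewrite !(pospX1 _ (- s)) ?oppr_le0// !(pospX1 _ (s - 1)) ?subr_le0//.
rewrite (_ : 1 + (s - 1) = s); last by ring.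
rewrite (ge0_posp s0) (@ge0_posp _ (1 - s)) ?subr_ge0//.
by field.
Qed.

Lemma integral01_cubic (a b c d : R) :
  integral01 (fun t => a + b * t + c * t ^+ 2 + d * t ^+ 3)
    (a + b / 2 + c / 3 + d / 4).
Proof.
apply: integral01_eq (integral01D (integral01D (integral01D
  (integral01Z a (integral01X 0)) (integral01Z b (integral01X 1)))
  (integral01Z c (integral01X 2))) (integral01Z d (integral01X 3))) _ _.
  by move=> t _; rewrite !expr1 expr0 mulr1.
by field.
Qed.

Variables a1 b1 a2 b2 a3 b3 : R.
Hypotheses (ab1 : a1 < b1) (ab2 : a2 < b2) (ab3 : a3 < b3).

(** The common shape of both volume computations. There is no constant term because the two slabs
    have height 0 over t1 = t3 = 0. Integrating in t1 leaves a cubic in t3, whose four coefficients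
    are grouped by degree in the result. *)
Lemma vol4_slab_quad (L U : R -> R -> R -> R) (p q b b' c d d' e f f' g : R) :
  measurable_fun3 L -> measurable_fun3 U ->
  (forall t1 t2 t3, 0 <= t1 <= 1 -> 0 <= t2 <= 1 -> 0 <= t3 <= 1 ->
    L t1 t2 t3 <= U t1 t2 t3) ->
  (forall t1 t3, 0 <= t1 <= 1 -> 0 <= t3 <= 1 ->
    integral01 (fun t2 => U t1 t2 t3 - L t1 t2 t3)
      (p * t3 + q * t3 ^+ 2 + (b + b' * t3) * t1 + c * t1 ^+ 2 +
       (d + d' * t3) * posp (t1 - t3) + e * posp (t1 - t3) ^+ 2 +
       (f + f' * t3) * posp (t1 + t3 - 1) + g * posp (t1 + t3 - 1) ^+ 2)) ->
  vol4 (slab a1 b1 a2 b2 a3 b3 L U) = ((b1 - a1) * (b2 - a2) * (b3 - a3) *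
    (b / 2 + c / 3 + d / 2 + e / 3 + (p + b' / 2 - d + d' / 2 - e) / 2 +
     (q + d / 2 - d' + e + f / 2) / 3 +
     (d' / 2 - e / 3 + f' / 2 + g / 3) / 4))%:E.
Proof.
move=> mL mU LU ig.
apply: (vol4_slab ab1 ab2 ab3 mL mU LU ig (h := fun s =>
  (b / 2 + c / 3 + d / 2 + e / 3) + (p + b' / 2 - d + d' / 2 - e) * s +
  (q + d / 2 - d' + e + f / 2) * s ^+ 2 +
  (d' / 2 - e / 3 + f' / 2 + g / 3) * s ^+ 3)); last exact: integral01_cubic.
move=> s s01; apply: integral01_eq (integral01_quad_posp _ _ _ _ _ _ _ s01) _ _.
  by move=> t _; reflexivity.
by field.
Qed.

End Quad.

(** * The trilinear hull *)

Section Slab.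
Context {R : realType}.
Variables a1 b1 a2 b2 a3 b3 : R.
Local Notation boxpt := (boxpt a1 b1 a2 b2 a3 b3).
Local Notation slab := (slab a1 b1 a2 b2 a3 b3).
Implicit Types (C : set (R4 R)) (L U : R -> R -> R -> R).

Lemma scale4 (k f x y z : R) :
  k *: ((f, x, y, z) : R4 R) = (k * f, k * x, k * y, k * z).
Proof. by []. Qed.

Lemma add4 (f x y z f' x' y' z' : R) : ((f, x, y, z) : R4 R) + (f', x', y', z') =
  (f + f', x + x', y + y', z + z').
Proof. by []. Qed.

Lemma boxpt_conv (t f f' x1 x2 x3 y1 y2 y3 : R) :
  t *: boxpt f x1 x2 x3 + (1 - t) *: boxpt f' y1 y2 y3 =
  boxpt (t * f + (1 - t) * f') (t * x1 + (1 - t) * y1)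
    (t * x2 + (1 - t) * y2) (t * x3 + (1 - t) * y3).
Proof.
by rewrite /boxpt !scale4 add4; congr (_, _, _, _); ring.
Qed.

Lemma convex_boxpt4 C (w x y z : R) (p q r s : R * R * R * R) f t1 t2 t3 :
  convex_set C ->
  C (boxpt p.1.1.1 p.1.1.2 p.1.2 p.2) -> C (boxpt q.1.1.1 q.1.1.2 q.1.2 q.2) ->
  C (boxpt r.1.1.1 r.1.1.2 r.1.2 r.2) -> C (boxpt s.1.1.1 s.1.1.2 s.1.2 s.2) ->
  0 <= w -> 0 <= x -> 0 <= y -> 0 <= z -> w + x + y + z = 1 ->
  f = w * p.1.1.1 + x * q.1.1.1 + y * r.1.1.1 + z * s.1.1.1 ->
  t1 = w * p.1.1.2 + x * q.1.1.2 + y * r.1.1.2 + z * s.1.1.2 ->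
  t2 = w * p.1.2 + x * q.1.2 + y * r.1.2 + z * s.1.2 ->
  t3 = w * p.2 + x * q.2 + y * r.2 + z * s.2 ->
  C (boxpt f t1 t2 t3).
Proof.
move=> cC Cp Cq Cr Cs w0 x0 y0 z0 wxyz -> -> -> ->.
have := convex_set_comb4 cC Cp Cq Cr Cs w0 x0 y0 z0 wxyz; congr (C _).
have -> : z = 1 - w - x - y by rewrite -wxyz; ring.
by rewrite /boxpt !scale4 !add4; congr (_, _, _, _) => /=; ring.
Qed.

Let conv01 (t x y : R) : 0 <= t <= 1 -> 0 <= x <= 1 -> 0 <= y <= 1 ->
  0 <= t * x + (1 - t) * y <= 1.
Proof. by move=> /andP[? ?] /andP[? ?] /andP[? ?]; apply/andP; split; nra. Qed.

(** A slab is the union of the vertical segments joining its two graphs. *)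
Lemma slab_sub_convex C L U : convex_set C ->
  (forall t1 t2 t3, 0 <= t1 <= 1 -> 0 <= t2 <= 1 -> 0 <= t3 <= 1 ->
    C (boxpt (L t1 t2 t3) t1 t2 t3) /\ C (boxpt (U t1 t2 t3) t1 t2 t3)) ->
  slab L U `<=` C.
Proof.
move=> cC CLU _ [f [t1 [t2 [t3 [-> h1 h2 h3 h]]]]].
have [CL CU] := CLU _ _ _ h1 h2 h3.
apply: (@convex_set_segment _ _ C (fun z => boxpt z t1 t2 t3) _ _ _ _ _ h) => //.
by move=> t; rewrite boxpt_conv; congr boxpt; ring.
Qed.

Lemma convex_slab L U :
  (forall t x1 x2 x3 y1 y2 y3, 0 <= t <= 1 ->
    L (t * x1 + (1 - t) * y1) (t * x2 + (1 - t) * y2) (t * x3 + (1 - t) * y3)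
      <= t * L x1 x2 x3 + (1 - t) * L y1 y2 y3) ->
  (forall t x1 x2 x3 y1 y2 y3, 0 <= t <= 1 ->
    t * U x1 x2 x3 + (1 - t) * U y1 y2 y3 <=
    U (t * x1 + (1 - t) * y1) (t * x2 + (1 - t) * y2) (t * x3 + (1 - t) * y3)) ->
  convex_set (slab L U).
Proof.
move=> cL cU; apply/convex_setP => _ _ t t01
  [f [x1 [x2 [x3 [-> hx1 hx2 hx3 /andP[Lf fU]]]]]]
  [g [y1 [y2 [y3 [-> hy1 hy2 hy3 /andP[Lg gU]]]]]].
rewrite boxpt_conv; do 4!eexists; split; first by [].
1-3: exact: conv01.
have [t0 t1] := andP t01; have s0 : 0 <= 1 - t by rewrite subr_ge0.
apply/andP; split.
  by apply: le_trans (cL _ _ _ _ _ _ _ t01) _; rewrite lerD// ler_wpM2l.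
by apply: le_trans (cU _ _ _ _ _ _ _ t01); rewrite lerD// ler_wpM2l.
Qed.

End Slab.

(** Selects in each positive part and each minimum the branch that follows linearly from the
    inequalities of the current cell. *)
Ltac resolve_piecewise := repeat match goal with
  | |- context [posp ?x] => (rewrite (@le0_posp _ x); [|lra]) ||
                            (rewrite (@ge0_posp _ x); [|lra])
  | |- context [Num.min ?x ?y] => (rewrite (@min_l _ _ x y); [|lra]) ||
                                  (rewrite (@min_r _ _ x y); [|lra])
  end.

(** * The two graphs that bound the trilinear hull *)

Section Hull.
Context {R : realType}.
Variables a1 b1 a2 b2 a3 b3 : R.
Hypotheses (ha1 : 0 <= a1) (hab1 : a1 < b1).
Hypotheses (ha2 : 0 <= a2) (hab2 : a2 < b2).
Hypotheses (ha3 : 0 <= a3) (hab3 : a3 < b3).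
Hypothesis hord1 : a1 * b2 * b3 + b1 * a2 * a3 <= b1 * a2 * b3 + a1 * b2 * a3.
Hypothesis hord2 : b1 * a2 * b3 + a1 * b2 * a3 <= b1 * b2 * a3 + a1 * a2 * b3.
Local Notation boxpt := (boxpt a1 b1 a2 b2 a3 b3).
Local Notation slab := (slab a1 b1 a2 b2 a3 b3).
Implicit Types (C : set (R4 R)).

(* The coefficients of x1 x2 x3 as a polynomial in t. *)
Let c1 := (b1 - a1) * a2 * a3.
Let c2 := a1 * (b2 - a2) * a3.
Let c3 := a1 * a2 * (b3 - a3).
Let c12 := (b1 - a1) * (b2 - a2) * a3.
Let c13 := (b1 - a1) * a2 * (b3 - a3).
Let c23 := a1 * (b2 - a2) * (b3 - a3).
Let c123 := (b1 - a1) * (b2 - a2) * (b3 - a3).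

(** The planes t1 + t2 + t3 = 1 and t1 + t2 + t3 = 2 cut off the two corner simplices; t1 + t2 = 1
    and t1 + t3 = 1 are planes through the diagonal from (1,0,0) to (0,1,1) and split the
    octahedron. Given these kinks, the values of x1 x2 x3 at the eight vertices determine the
    coefficients. *)
Definition trilinear_lower t1 t2 t3 : R :=
  a1 * a2 * a3 + c1 * t1 + c2 * t2 + c3 * t3 +
  c23 * posp (t1 + t2 + t3 - 1) + (c12 - c23) * posp (t1 + t2 - 1) +
  (c13 - c23) * posp (t1 + t3 - 1) + (c23 + c123) * posp (t1 + t2 + t3 - 2).

(** Each monomial in t is replaced by the minimum of its variables. The triple minimum is nested so
    that at fixed t1 and t3 it is a single minimum with t2. *)
Definition trilinear_upper t1 t2 t3 : R :=
  a1 * a2 * a3 + c1 * t1 + c2 * t2 + c3 * t3 +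
  c12 * Num.min t1 t2 + c13 * Num.min t1 t3 + c23 * Num.min t2 t3 +
  c123 * Num.min (Num.min t1 t3) t2.

Let d1_gt0 : 0 < b1 - a1. Proof. by rewrite subr_gt0. Qed.
Let d2_gt0 : 0 < b2 - a2. Proof. by rewrite subr_gt0. Qed.
Let d3_gt0 : 0 < b3 - a3. Proof. by rewrite subr_gt0. Qed.
Let c12_ge0 : 0 <= c12. Proof. by rewrite !mulr_ge0// ltW. Qed.
Let c13_ge0 : 0 <= c13. Proof. by rewrite !mulr_ge0// ltW. Qed.
Let c23_ge0 : 0 <= c23. Proof. by rewrite !mulr_ge0// ltW. Qed.
Let c123_ge0 : 0 <= c123. Proof. by rewrite !mulr_ge0// ltW. Qed.

(** The gap [c13 - c23] is (b3 - a3)(b1 a2 - a1 b2), which expands to the difference of the two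
    sides of [hord1]; in the same way [c12 - c13] is that of [hord2]. *)
Let c23_le13 : c23 <= c13.
Proof.
rewrite -subr_ge0; move: hord1; rewrite -subr_ge0; congr (0 <= _).
by rewrite /c13 /c23; ring.
Qed.

Let c13_le12 : c13 <= c12.
Proof.
rewrite -subr_ge0; move: hord2; rewrite -subr_ge0; congr (0 <= _).
by rewrite /c12 /c13; ring.
Qed.

Let c23_le12 : c23 <= c12. Proof. exact: le_trans c13_le12. Qed.

Let affine_part_conv (t x1 x2 x3 y1 y2 y3 p q r s p' q' r' s' : R) :
  a1 * a2 * a3 + c1 * (t * x1 + (1 - t) * y1) + c2 * (t * x2 + (1 - t) * y2) +
    c3 * (t * x3 + (1 - t) * y3) + (t * p + (1 - t) * p') +
    (t * q + (1 - t) * q') + (t * r + (1 - t) * r') + (t * s + (1 - t) * s') =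
  t * (a1 * a2 * a3 + c1 * x1 + c2 * x2 + c3 * x3 + p + q + r + s) +
  (1 - t) * (a1 * a2 * a3 + c1 * y1 + c2 * y2 + c3 * y3 + p' + q' + r' + s').
Proof. by ring. Qed.

(** All positive parts must carry nonnegative weights; for the kinks through the diagonal this is
    [c23 <= c12] and [c23 <= c13]. *)
Lemma trilinear_lower_convex t x1 x2 x3 y1 y2 y3 : 0 <= t <= 1 ->
  trilinear_lower (t * x1 + (1 - t) * y1) (t * x2 + (1 - t) * y2)
    (t * x3 + (1 - t) * y3) <=
  t * trilinear_lower x1 x2 x3 + (1 - t) * trilinear_lower y1 y2 y3.
Proof.
move=> t01; rewrite /trilinear_lower.
have pC c g x y : 0 <= c -> g = t * x + (1 - t) * y ->
    c * posp g <= t * (c * posp x) + (1 - t) * (c * posp y).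
  move=> c0 ->; apply: le_trans (ler_wpM2l c0 (posp_convex _ _ t01)) _.
  by rewrite le_eqVlt; apply/orP; left; apply/eqP; ring.
by rewrite -affine_part_conv !lerD//; apply: pC; rewrite ?subr_ge0 ?addr_ge0//;
  ring.
Qed.

Lemma trilinear_upper_concave t x1 x2 x3 y1 y2 y3 : 0 <= t <= 1 ->
  t * trilinear_upper x1 x2 x3 + (1 - t) * trilinear_upper y1 y2 y3 <=
  trilinear_upper (t * x1 + (1 - t) * y1) (t * x2 + (1 - t) * y2)
    (t * x3 + (1 - t) * y3).
Proof.
move=> t01; rewrite /trilinear_upper.
have mC c g x y : 0 <= c -> t * x + (1 - t) * y <= g ->
    t * (c * x) + (1 - t) * (c * y) <= c * g.
  move=> c0 /(ler_wpM2l c0); apply: le_trans.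
  by rewrite le_eqVlt; apply/orP; left; apply/eqP; ring.
rewrite -affine_part_conv !lerD//; apply: mC => //; try exact: min_concave.
apply: le_trans (min_concave _ _ _ _ t01) _.
by rewrite le_min ge_min min_concave//= ge_min lexx orbT.
Qed.

Lemma trilinear_vertex_slab t1 t2 t3 : (t1 == 0) || (t1 == 1) ->
  (t2 == 0) || (t2 == 1) -> (t3 == 0) || (t3 == 1) ->
  slab trilinear_lower trilinear_upper (boxpt
    ((a1 + (b1 - a1) * t1) * (a2 + (b2 - a2) * t2) * (a3 + (b3 - a3) * t3))
    t1 t2 t3).
Proof.
have box01 t : (t == 0) || (t == 1) -> 0 <= t <= 1.
  by move=> /orP[]/eqP->; rewrite lexx ler01.
move=> h1 h2 h3; do 4!eexists; split; [by []|exact: box01..|].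
have LE x y z : x = y -> z = y -> x <= y <= z by move=> -> ->; rewrite lexx.
move: h1 h2 h3 => /orP[]/eqP-> /orP[]/eqP-> /orP[]/eqP->;
rewrite /trilinear_lower /trilinear_upper; resolve_piecewise;
apply: LE; rewrite /c1 /c2 /c3 /c12 /c13 /c23 /c123; ring.
Qed.

(** On each cell the function is affine and agrees with x1 x2 x3 at the four vertices, so the
    barycentric coordinates of t express the graph point as a convex combination. Leaving [C]
    arbitrary allows its use both for the hull and for the slab. *)
Lemma trilinear_graphs_sub C t1 t2 t3 : convex_set C ->
  (forall t1 t2 t3, (t1 == 0) || (t1 == 1) ->
    (t2 == 0) || (t2 == 1) -> (t3 == 0) || (t3 == 1) -> C (boxpt
    ((a1 + (b1 - a1) * t1) * (a2 + (b2 - a2) * t2) * (a3 + (b3 - a3) * t3))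
    t1 t2 t3)) ->
  0 <= t1 <= 1 -> 0 <= t2 <= 1 -> 0 <= t3 <= 1 ->
  C (boxpt (trilinear_lower t1 t2 t3) t1 t2 t3) /\
  C (boxpt (trilinear_upper t1 t2 t3) t1 t2 t3).
Proof.
move=> cC CV /andP[t10 t11] /andP[t20 t21] /andP[t30 t31].
pose m x y z :=
  (a1 + (b1 - a1) * x) * (a2 + (b2 - a2) * y) * (a3 + (b3 - a3) * z).
pose v x y z : R * R * R * R := (m x y z, x, y, z).
have Vv x y z : (x == 0) || (x == 1) -> (y == 0) || (y == 1) ->
    (z == 0) || (z == 1) -> C (boxpt (v x y z).1.1.1 x y z) by exact: CV.
have V000 := Vv 0 0 0; have V100 := Vv 1 0 0; have V010 := Vv 0 1 0.
have V001 := Vv 0 0 1; have V110 := Vv 1 1 0; have V101 := Vv 1 0 1.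
have V011 := Vv 0 1 1; have V111 := Vv 1 1 1.
move: {CV Vv} V000 V100 V010 V001 V110 V101 V011 V111; rewrite !eqxx !orbT/=.
move=> /(_ isT isT isT) V000 /(_ isT isT isT) V100 /(_ isT isT isT) V010
  /(_ isT isT isT) V001 /(_ isT isT isT) V110 /(_ isT isT isT) V101
  /(_ isT isT isT) V011 /(_ isT isT isT) V111.
split.
- have /orP[s1|s1] := le_total (t1 + t2 + t3) 1.
    apply: (@convex_boxpt4 _ _ _ _ _ _ _ C (1 - t1 - t2 - t3) t1 t2 t3
      (v 0 0 0) (v 1 0 0) (v 0 1 0) (v 0 0 1)) => //=; try lra.
    rewrite /trilinear_lower /trilinear_upper; resolve_piecewise.
    by rewrite /m /c1 /c2 /c3 /c12 /c13 /c23 /c123; ring.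
  have /orP[s2|s2] := le_total 2 (t1 + t2 + t3).
    apply: (@convex_boxpt4 _ _ _ _ _ _ _ C
      (t1 + t2 + t3 - 2) (1 - t1) (1 - t2) (1 - t3)
      (v 1 1 1) (v 0 1 1) (v 1 0 1) (v 1 1 0)) => //=; try lra.
    rewrite /trilinear_lower /trilinear_upper; resolve_piecewise.
    by rewrite /m /c1 /c2 /c3 /c12 /c13 /c23 /c123; ring.
  (* The signs of t1 + t2 - 1 and t1 + t3 - 1 tell the four simplices of the octahedron apart; each
     has (1,0,0) and (0,1,1) among its vertices. *)
  have /orP[s12|s12] := le_total (t1 + t2) 1;
    have /orP[s13|s13] := le_total (t1 + t3) 1.
  + apply: (@convex_boxpt4 _ _ _ _ _ _ _ C
      (t1 + t2 + t3 - 1) t1 (1 - t1 - t3) (1 - t1 - t2)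
      (v 0 1 1) (v 1 0 0) (v 0 1 0) (v 0 0 1)) => //=; try lra.
    rewrite /trilinear_lower /trilinear_upper; resolve_piecewise.
    by rewrite /m /c1 /c2 /c3 /c12 /c13 /c23 /c123; ring.
  + apply: (@convex_boxpt4 _ _ _ _ _ _ _ C t2 (1 - t3) (t1 + t3 - 1) (1 - t1 - t2)
      (v 0 1 1) (v 1 0 0) (v 1 0 1) (v 0 0 1)) => //=; try lra.
    rewrite /trilinear_lower /trilinear_upper; resolve_piecewise.
    by rewrite /m /c1 /c2 /c3 /c12 /c13 /c23 /c123; ring.
  + apply: (@convex_boxpt4 _ _ _ _ _ _ _ C t3 (1 - t2) (t1 + t2 - 1) (1 - t1 - t3)
      (v 0 1 1) (v 1 0 0) (v 1 1 0) (v 0 1 0)) => //=; try lra.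
    rewrite /trilinear_lower /trilinear_upper; resolve_piecewise.
    by rewrite /m /c1 /c2 /c3 /c12 /c13 /c23 /c123; ring.
  + apply: (@convex_boxpt4 _ _ _ _ _ _ _ C
      (2 - t1 - t2 - t3) (1 - t1) (t1 + t3 - 1) (t1 + t2 - 1)
      (v 1 0 0) (v 0 1 1) (v 1 0 1) (v 1 1 0)) => //=; try lra.
    rewrite /trilinear_lower /trilinear_upper; resolve_piecewise.
    by rewrite /m /c1 /c2 /c3 /c12 /c13 /c23 /c123; ring.
(* On a Kuhn simplex the weights are the gaps of the sorted coordinates between 0 and 1, and the
   vertices arise from the origin by raising coordinates to 1 in decreasing order. *)
- have /orP[h12|h12] := le_total t1 t2.
  + have /orP[h23|h23] := le_total t2 t3;
    last have /orP[h13|h13] := le_total t1 t3.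
    * apply: (@convex_boxpt4 _ _ _ _ _ _ _ C (1 - t3) (t3 - t2) (t2 - t1) t1
        (v 0 0 0) (v 0 0 1) (v 0 1 1) (v 1 1 1)) => //=; try lra.
      rewrite /trilinear_lower /trilinear_upper; resolve_piecewise.
      by rewrite /m /c1 /c2 /c3 /c12 /c13 /c23 /c123; ring.
    * apply: (@convex_boxpt4 _ _ _ _ _ _ _ C (1 - t2) (t2 - t3) (t3 - t1) t1
        (v 0 0 0) (v 0 1 0) (v 0 1 1) (v 1 1 1)) => //=; try lra.
      rewrite /trilinear_lower /trilinear_upper; resolve_piecewise.
      by rewrite /m /c1 /c2 /c3 /c12 /c13 /c23 /c123; ring.
    * apply: (@convex_boxpt4 _ _ _ _ _ _ _ C (1 - t2) (t2 - t1) (t1 - t3) t3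
        (v 0 0 0) (v 0 1 0) (v 1 1 0) (v 1 1 1)) => //=; try lra.
      rewrite /trilinear_lower /trilinear_upper; resolve_piecewise.
      by rewrite /m /c1 /c2 /c3 /c12 /c13 /c23 /c123; ring.
  + have /orP[h13|h13] := le_total t1 t3;
    last have /orP[h23|h23] := le_total t2 t3.
    * apply: (@convex_boxpt4 _ _ _ _ _ _ _ C (1 - t3) (t3 - t1) (t1 - t2) t2
        (v 0 0 0) (v 0 0 1) (v 1 0 1) (v 1 1 1)) => //=; try lra.
      rewrite /trilinear_lower /trilinear_upper; resolve_piecewise.
      by rewrite /m /c1 /c2 /c3 /c12 /c13 /c23 /c123; ring.
    * apply: (@convex_boxpt4 _ _ _ _ _ _ _ C (1 - t1) (t1 - t3) (t3 - t2) t2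
        (v 0 0 0) (v 1 0 0) (v 1 0 1) (v 1 1 1)) => //=; try lra.
      rewrite /trilinear_lower /trilinear_upper; resolve_piecewise.
      by rewrite /m /c1 /c2 /c3 /c12 /c13 /c23 /c123; ring.
    * apply: (@convex_boxpt4 _ _ _ _ _ _ _ C (1 - t1) (t1 - t2) (t2 - t3) t3
        (v 0 0 0) (v 1 0 0) (v 1 1 0) (v 1 1 1)) => //=; try lra.
      rewrite /trilinear_lower /trilinear_upper; resolve_piecewise.
      by rewrite /m /c1 /c2 /c3 /c12 /c13 /c23 /c123; ring.
Qed.

End Hull.

(** * The hull as a slab, and its volume *)

Section HullVolume.
Context {R : realType}.
Variables a1 b1 a2 b2 a3 b3 : R.
Hypotheses (ha1 : 0 <= a1) (hab1 : a1 < b1).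
Hypotheses (ha2 : 0 <= a2) (hab2 : a2 < b2).
Hypotheses (ha3 : 0 <= a3) (hab3 : a3 < b3).
Hypothesis hord1 : a1 * b2 * b3 + b1 * a2 * a3 <= b1 * a2 * b3 + a1 * b2 * a3.
Hypothesis hord2 : b1 * a2 * b3 + a1 * b2 * a3 <= b1 * b2 * a3 + a1 * a2 * b3.
Local Notation lower := (trilinear_lower a1 b1 a2 b2 a3 b3).
Local Notation upper := (trilinear_upper a1 b1 a2 b2 a3 b3).

Let convex_trilinear_slab : convex_set (slab a1 b1 a2 b2 a3 b3 lower upper).
Proof.
by apply: convex_slab => *; [exact: trilinear_lower_convex|
                             exact: trilinear_upper_concave].
Qed.

Lemma trilinear_hullE : trilinear_hull a1 b1 a2 b2 a3 b3 =
  slab a1 b1 a2 b2 a3 b3 lower upper.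
Proof.
have endpoint (a b : R) x : [set a; b] x ->
    exists t, (t == 0) || (t == 1) /\ x = a + (b - a) * t.
  case=> ->; [exists 0|exists 1]; rewrite eqxx ?orbT; split => //.
    by rewrite mulr0 addr0.
  by rewrite mulr1 addrC subrK.
have endpoint' (a b : R) t : (t == 0) || (t == 1) -> [set a; b] (a + (b - a) * t).
  by move=> /orP[]/eqP->; [left; rewrite mulr0 addr0|
                            right; rewrite mulr1 addrC subrK].
apply/seteqP; split=> [p|].
  apply; split; first exact: convex_trilinear_slab.
  move=> _ [_ [_ [_ [/endpoint[t1 [h1 ->]] /endpoint[t2 [h2 ->]]
    /endpoint[t3 [h3 ->]] ->]]]].
  exact: trilinear_vertex_slab.
move=> p sp C [cC SC]; apply: (slab_sub_convex cC _ sp) => t1 t2 t3.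
apply: trilinear_graphs_sub => // x1 x2 x3 h1 h2 h3; apply: SC.
by do 3!eexists; split; last reflexivity; exact: endpoint'.
Qed.

(** The slab is convex and contains the vertices, so it contains the graph of its own lower bound,
    which therefore lies below the upper one. *)
Lemma trilinear_lower_le_upper t1 t2 t3 :
  0 <= t1 <= 1 -> 0 <= t2 <= 1 -> 0 <= t3 <= 1 -> lower t1 t2 t3 <= upper t1 t2 t3.
Proof.
move=> h1 h2 h3; have V := @trilinear_vertex_slab _ a1 b1 a2 b2 a3 b3.
have [+ _] := trilinear_graphs_sub convex_trilinear_slab V h1 h2 h3.
by move=> /(slab_boxpt hab1 hab2 hab3)/andP[].
Qed.

Lemma measurable_trilinear_lower : measurable_fun3 lower.
Proof.
rewrite /measurable_fun3 /trilinear_lower.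
by do ![exact: measurable_cst|apply: measurable_funD|apply: measurable_funM|
  apply: measurable_posp|apply: measurable_funB|exact: measurable_snd|
  apply: (measurableT_comp measurable_snd)|apply: (measurableT_comp measurable_fst)|
  exact: measurable_fst].
Qed.

Lemma measurable_trilinear_upper : measurable_fun3 upper.
Proof.
rewrite /measurable_fun3 /trilinear_upper.
by do ![apply: measurable_funD|apply: measurable_funM|apply: measurable_minr|
  apply: measurable_funB|exact: measurable_cst|exact: measurable_snd|
  apply: (measurableT_comp measurable_snd)|apply: (measurableT_comp measurable_fst)|
  exact: measurable_fst].
Qed.

Lemma vol4_trilinear_hull : vol4 (trilinear_hull a1 b1 a2 b2 a3 b3) =
  ((b1 - a1) * (b2 - a2) * (b3 - a3) *
   (b1 * (5 * b2 * b3 - a2 * b3 - b2 * a3 - 3 * a2 * a3) +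
    a1 * (5 * a2 * a3 - b2 * a3 - a2 * b3 - 3 * b2 * b3)) / 24)%:E.
Proof.
pose c12 := (b1 - a1) * (b2 - a2) * a3; pose c13 := (b1 - a1) * a2 * (b3 - a3).
pose c23 := a1 * (b2 - a2) * (b3 - a3).
pose c123 := (b1 - a1) * (b2 - a2) * (b3 - a3).
(* These are the coefficients of the t2-integral computed below, once min(t1, t3) is written as t1 -
   posp(t1 - t3). *)
rewrite trilinear_hullE (@vol4_slab_quad _ _ _ _ _ _ _ hab1 hab2 hab3 lower upper
  c23 (- c23) (c12 + c13 + c123) (- c23) (- c12 - c123 / 2) (- c13 - c123) c123
  (c123 / 2) (c23 - c13) 0 (- (c123 / 2)) measurable_trilinear_lower
  measurable_trilinear_upper trilinear_lower_le_upper).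
  by congr EFin; rewrite /c12 /c13 /c23 /c123; field.
move=> t1 t3 /andP[t10 t11] /andP[t30 t31].
pose m := Num.min t1 t3.
apply: integral01_eq (integral01D (integral01D (integral01D (integral01D
  (integral01D (integral01D
    (integral01Z (c12 * t1 + c13 * m + c23 * t3 + c123 * m -
       (c13 - c23) * posp (t1 + t3 - 1)) (integral01X 0))
    (integral01Z (- c12) (integral01_pospB 0 t1)))
  (integral01Z (- c23) (integral01_pospB 0 t3)))
  (integral01Z (- c123) (integral01_pospB 0 m)))
  (integral01Z (- c23) (integral01_pospD 0 (t1 + t3 - 1))))
  (integral01Z (c23 - c12) (integral01_pospD 0 (t1 - 1))))
  (integral01Z (- c23 - c123) (integral01_pospD 0 (t1 + t3 - 2)))) _ _.
  move=> t2 _; rewrite /lower /upper.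
  rewrite (min_posp t1 t2) (minC t2 t3) (min_posp t3 t2) (min_posp _ t2) -/m.
  rewrite (_ : t1 + t2 + t3 - 1 = t2 + (t1 + t3 - 1)); last by ring.
  rewrite (_ : t1 + t2 + t3 - 2 = t2 + (t1 + t3 - 2)); last by ring.
  rewrite (_ : t1 + t2 - 1 = t2 + (t1 - 1)); last by ring.
  by rewrite /c12 /c13 /c23 /c123 !expr1 expr0; ring.
have m0 : 0 <= m by rewrite le_min t10.
have m1 : m <= 1 by rewrite ge_min t11.
rewrite (_ : 1 + (t1 + t3 - 2) = t1 + t3 - 1); last by ring.
rewrite (_ : 1 + (t1 + t3 - 1) = t1 + t3); last by ring.
rewrite (_ : 1 + (t1 - 1) = t1); last by ring.
rewrite (ge0_posp t10) (ge0_posp t30) (ge0_posp m0) (ge0_posp (addr_ge0 t10 t30)).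
have m10 : m - 1 <= 0 by rewrite subr_le0.
have t110 : t1 - 1 <= 0 by rewrite subr_le0.
have t310 : t3 - 1 <= 0 by rewrite subr_le0.
have t1320 : t1 + t3 - 2 <= 0 by lra.
rewrite (le0_posp m10) (le0_posp t110) (le0_posp t310) (le0_posp t1320).
have -> : posp (t1 - t3) = t1 - m by rewrite /m min_posp; ring.
(* The algebraic trace of m being one of t1 and t3; the remaining goal is a polynomial identity
   modulo this relation. *)
have mm : (t1 - m) * (t3 - m) = 0.
  by rewrite /m; case: leP => _; rewrite subrr ?mul0r ?mulr0.
apply/eqP; rewrite -subr_eq0; apply/eqP.
transitivity (- c123 * ((t1 - m) * (t3 - m))); last by rewrite mm mulr0.
by field.
Qed.

End HullVolume.

(** * The double McCormick relaxation *)

Section ExtremePoints.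
Context {R : realType}.
Variables a1 b1 a2 b2 a3 b3 : R.
Hypotheses (hab1 : a1 < b1) (hab2 : a2 < b2) (hab3 : a3 < b3).
Local Notation boxpt := (boxpt a1 b1 a2 b2 a3 b3).
Local Notation slab := (slab a1 b1 a2 b2 a3 b3).
Implicit Types (L U : R -> R -> R -> R) (f t x y z : R).

Let conv_eq0 t x y : 0 < t -> t < 1 -> 0 <= x -> 0 <= y ->
  t * x + (1 - t) * y = 0 -> x = 0 /\ y = 0.
Proof.
move=> t0 t1 x0 y0 xy; have s0 : 0 < 1 - t by rewrite subr_gt0.
have tx := mulr_ge0 (ltW t0) x0; have sy := mulr_ge0 (ltW s0) y0.
have : t * x = 0 by apply/eqP; rewrite eq_le tx andbT -xy lerDl.
have : (1 - t) * y = 0 by apply/eqP; rewrite eq_le sy andbT -xy lerDr.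
by move=> /eqP; rewrite mulf_eq0 (gt_eqF s0) => /eqP-> /eqP;
  rewrite mulf_eq0 (gt_eqF t0) => /eqP->.
Qed.

Let conv_01 t e x y : 0 < t -> t < 1 -> (e == 0) || (e == 1) ->
  0 <= x <= 1 -> 0 <= y <= 1 -> e = t * x + (1 - t) * y -> x = e /\ y = e.
Proof.
move=> t0 t1 /orP[]/eqP-> /andP[x0 x1] /andP[y0 y1] xy.
  exact: conv_eq0 t0 t1 x0 y0 (esym xy).
have x1' : 0 <= 1 - x by rewrite subr_ge0.
have y1' : 0 <= 1 - y by rewrite subr_ge0.
have [|/eqP + /eqP] := conv_eq0 t0 t1 x1' y1'.
  transitivity (1 - (t * x + (1 - t) * y)); first by ring.
  by rewrite -xy subrr.
by rewrite !subr_eq0 => /eqP<- /eqP<-.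
Qed.

Let boxpt_inj f t1 t2 t3 g x1 x2 x3 : boxpt f t1 t2 t3 = boxpt g x1 x2 x3 ->
  [/\ f = g, t1 = x1, t2 = x2 & t3 = x3].
Proof.
have d0 (a b : R) : a < b -> b - a != 0 by move=> ab; rewrite subr_eq0 gt_eqF.
by move=> [-> /addrI/(mulfI (d0 _ _ hab1)) -> /addrI/(mulfI (d0 _ _ hab2)) ->
  /addrI/(mulfI (d0 _ _ hab3)) ->].
Qed.

(** A vertex of the cube is extreme in the cube, so both ends of the segment project to it, and the
    fibre of the slab there is a single point. *)
Lemma extreme_slab_vertex L U f t1 t2 t3 : (t1 == 0) || (t1 == 1) ->
  (t2 == 0) || (t2 == 1) -> (t3 == 0) || (t3 == 1) ->
  L t1 t2 t3 = f -> U t1 t2 t3 = f ->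
  slab L U (boxpt f t1 t2 t3) -> extreme_points (slab L U) (boxpt f t1 t2 t3).
Proof.
move=> h1 h2 h3 Lf Uf S; split=> // _ _ t
  [g [x1 [x2 [x3 [-> hx1 hx2 hx3 /andP[Lg gU]]]]]]
  [h [y1 [y2 [y3 [-> hy1 hy2 hy3 /andP[Lh hU]]]]]] t0 tlt1.
rewrite boxpt_conv => /boxpt_inj[_ e1 e2 e3].
have [] := conv_01 t0 tlt1 h1 hx1 hy1 e1; have [] := conv_01 t0 tlt1 h2 hx2 hy2 e2.
have [] := conv_01 t0 tlt1 h3 hx3 hy3 e3.
move=> ? ? ? ? ? ?; subst x1 x2 x3 y1 y2 y3.
move: Lg gU Lh hU; rewrite Lf Uf => Lg gU Lh hU.
by split; congr boxpt; apply/le_anti/andP.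
Qed.

(* The two affine constraints [u f + p + q t2 >= 0] are tight at the point and
   independent, so they determine [f] and [t2] on the edge of the box. *)
Lemma extreme_slab_edge L U f t1 t2 t3 (u p q u' p' q' : R) :
  (t1 == 0) || (t1 == 1) -> (t3 == 0) || (t3 == 1) ->
  (forall g x, 0 <= x <= 1 -> L t1 x t3 <= g <= U t1 x t3 ->
    0 <= u * g + p + q * x /\ 0 <= u' * g + p' + q' * x) ->
  u * f + p + q * t2 = 0 -> u' * f + p' + q' * t2 = 0 ->
  u * q' - u' * q != 0 ->
  slab L U (boxpt f t1 t2 t3) -> extreme_points (slab L U) (boxpt f t1 t2 t3).
Proof.
move=> h1 h3 LU uf uf' det S; split=> // _ _ t
  [g [x1 [x2 [x3 [-> hx1 hx2 hx3 gLU]]]]]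
  [h [y1 [y2 [y3 [-> hy1 hy2 hy3 hLU]]]]] t0 tlt1.
rewrite boxpt_conv => /boxpt_inj[e0 e1 e2 e3].
have [] := conv_01 t0 tlt1 h1 hx1 hy1 e1; have [] := conv_01 t0 tlt1 h3 hx3 hy3 e3.
move=> ? ? ? ?; subst x1 x3 y1 y3.
have [gu gu'] := LU _ _ hx2 gLU; have [hu hu'] := LU _ _ hy2 hLU.
have [|g0 h0] := conv_eq0 t0 tlt1 gu hu.
  by rewrite -[RHS]uf e0 e2; ring.
have [|g0' h0'] := conv_eq0 t0 tlt1 gu' hu'.
  by rewrite -[RHS]uf' e0 e2; ring.
have uniq g' x' : u * g' + p + q * x' = 0 -> u' * g' + p' + q' * x' = 0 ->
    g' = f /\ x' = t2.
  move=> E E'.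
  have Ef : (u * q' - u' * q) * (g' - f) = 0.
    transitivity (q' * ((u * g' + p + q * x') - (u * f + p + q * t2)) -
      q * ((u' * g' + p' + q' * x') - (u' * f + p' + q' * t2))); first by ring.
    by rewrite E E' uf uf' !subrr !mulr0 subrr.
  have Et : (u * q' - u' * q) * (x' - t2) = 0.
    transitivity (u * ((u' * g' + p' + q' * x') - (u' * f + p' + q' * t2)) -
      u' * ((u * g' + p + q * x') - (u * f + p + q * t2))); first by ring.
    by rewrite E E' uf uf' !subrr !mulr0 subrr.
  move: Ef Et => /eqP + /eqP; rewrite !mulf_eq0 (negbTE det)/= !subr_eq0.
  by move=> /eqP-> /eqP->.
by have [-> ->] := uniq _ _ g0 g0'; have [-> ->] := uniq _ _ h0 h0'.
Qed.

End ExtremePoints.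

(** * The relaxation in normalized coordinates *)

Section DoubleMcCormick.
Context {R : realType}.
Variables a1 b1 a2 b2 a3 b3 : R.
Hypotheses (ha1 : 0 <= a1) (hab1 : a1 < b1).
Hypotheses (ha2 : 0 <= a2) (hab2 : a2 < b2).
Hypotheses (ha3 : 0 <= a3) (hab3 : a3 < b3).
Local Notation boxpt := (boxpt a1 b1 a2 b2 a3 b3).
Local Notation slab := (slab a1 b1 a2 b2 a3 b3).
Local Notation P2 := (double_mccormick2 a1 b1 a2 b2 a3 b3).
Implicit Types (C : set (R4 R)).

Let D := b1 * b3 - a1 * a3.
(** The product x1 x3 equals a1 a3 + D (al t1 + be t3 + ga t1 t3), where [al], [be], [ga] are
    nonnegative with sum 1. The McCormick bounds replace t1 t3 by the bounds posp(t1 + t3 - 1) and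
    min(t1, t3). *)
Let al := a3 * (b1 - a1) / D.
Let be := a1 * (b3 - a3) / D.
Let ga := 1 - al - be.

Let D_gt0 : 0 < D.
Proof.
rewrite /D subr_gt0; apply: (@le_lt_trans _ _ (a1 * b3)).
  by rewrite ler_wpM2l// ltW.
by rewrite ltr_pM2r// (le_lt_trans ha3).
Qed.

Let D_neq0 : D != 0. Proof. by rewrite gt_eqF. Qed.
Let d1_gt0 : 0 < b1 - a1. Proof. by rewrite subr_gt0. Qed.
Let d2_gt0 : 0 < b2 - a2. Proof. by rewrite subr_gt0. Qed.
Let d3_gt0 : 0 < b3 - a3. Proof. by rewrite subr_gt0. Qed.
Let al_ge0 : 0 <= al. Proof. by rewrite divr_ge0 ?mulr_ge0// ltW. Qed.
Let be_ge0 : 0 <= be. Proof. by rewrite divr_ge0 ?mulr_ge0// ltW. Qed.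
Let gaE : ga = (b1 - a1) * (b3 - a3) / D.
Proof. by rewrite /ga /al /be /D; field. Qed.
Let ga_gt0 : 0 < ga. Proof. by rewrite gaE divr_gt0 ?mulr_gt0. Qed.

(* [w = a1 a3 + D s]: the bounds on [w = x1 x3] become bounds on [s] with
   values in [0, 1], and [f = a1 a3 x2 + D g] turns [f = w x2] into [g = s x2]. *)
Definition mccormick_lower_w t1 t3 := al * t1 + be * t3 + ga * posp (t1 + t3 - 1).
Definition mccormick_upper_w t1 t3 := al * t1 + be * t3 + ga * Num.min t1 t3.
Local Notation sl := mccormick_lower_w.
Local Notation su := mccormick_upper_w.

Definition mccormick_boxpt g t1 t2 t3 : R4 R :=
  boxpt (a1 * a3 * (a2 + (b2 - a2) * t2) + D * g) t1 t2 t3.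
Local Notation mpt := mccormick_boxpt.

Definition double_mccormick_lower t1 t2 t3 :=
  a1 * a3 * (a2 + (b2 - a2) * t2) +
  D * (a2 * sl t1 t3 + (b2 - a2) * posp (sl t1 t3 + t2 - 1)).
Definition double_mccormick_upper t1 t2 t3 :=
  a1 * a3 * (a2 + (b2 - a2) * t2) +
  D * (a2 * su t1 t3 + (b2 - a2) * Num.min (su t1 t3) t2).
Local Notation lower := double_mccormick_lower.
Local Notation upper := double_mccormick_upper.

Let mccormick_w s t1 t3 :
  mccormick a1 b1 a3 b3 (a1 * a3 + D * s) (a1 + (b1 - a1) * t1)
    (a3 + (b3 - a3) * t3) <->
  [/\ 0 <= s - (al * t1 + be * t3), 0 <= (1 - be) * t1 + be * t3 - s,
      0 <= al * t1 + (1 - al) * t3 - s &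
      0 <= s - ((1 - be) * t1 + (1 - al) * t3 - ga)].
Proof.
set x1 := a1 + _; set x3 := a3 + _; set w := a1 * a3 + _.
have E1 : w - a3 * x1 - a1 * x3 + a1 * a3 = D * (s - (al * t1 + be * t3)).
  by rewrite /w /x1 /x3 /al /be; field.
have E2 : - w + b3 * x1 + a1 * x3 - a1 * b3 = D * ((1 - be) * t1 + be * t3 - s).
  by rewrite /w /x1 /x3 /be; move: D_neq0; rewrite /D => ?; field.
have E3 : - w + a3 * x1 + b1 * x3 - b1 * a3 = D * (al * t1 + (1 - al) * t3 - s).
  by rewrite /w /x1 /x3 /al; move: D_neq0; rewrite /D => ?; field.
have E4 : w - b3 * x1 - b1 * x3 + b1 * b3 =
    D * (s - ((1 - be) * t1 + (1 - al) * t3 - ga)).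
  by rewrite /w /x1 /x3 /ga /al /be; move: D_neq0; rewrite /D => ?; field.
by rewrite /mccormick E1 E2 E3 E4 !pmulr_rge0.
Qed.

Let mccormick_f g s t2 :
  mccormick (a1 * a3) (b1 * b3) a2 b2
    (a1 * a3 * (a2 + (b2 - a2) * t2) + D * g) (a1 * a3 + D * s)
    (a2 + (b2 - a2) * t2) <->
  [/\ 0 <= g - a2 * s, 0 <= b2 * s - g, 0 <= a2 * s + (b2 - a2) * t2 - g &
      0 <= g - (a2 * s + (b2 - a2) * (s + t2 - 1))].
Proof.
set x2 := a2 + _; set w := a1 * a3 + D * s; set f := _ + D * g.
have E1 : f - a2 * w - a1 * a3 * x2 + a1 * a3 * a2 = D * (g - a2 * s).
  by rewrite /f /w; ring.
have E2 : - f + b2 * w + a1 * a3 * x2 - a1 * a3 * b2 = D * (b2 * s - g).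
  by rewrite /f /w; ring.
have E3 : - f + a2 * w + b1 * b3 * x2 - b1 * b3 * a2 =
    D * (a2 * s + (b2 - a2) * t2 - g).
  by rewrite /f /w /x2 /D; ring.
have E4 : f - b2 * w - b1 * b3 * x2 + b1 * b3 * b2 =
    D * (g - (a2 * s + (b2 - a2) * (s + t2 - 1))).
  by rewrite /f /w /x2 /D; ring.
by rewrite /mccormick E1 E2 E3 E4 !pmulr_rge0.
Qed.

Lemma double_mccormick2_mpt g t1 t2 t3 : P2 (mpt g t1 t2 t3) <->
  exists s, [/\ 0 <= s - (al * t1 + be * t3), 0 <= (1 - be) * t1 + be * t3 - s,
      0 <= al * t1 + (1 - al) * t3 - s &
      0 <= s - ((1 - be) * t1 + (1 - al) * t3 - ga)] /\
  [/\ 0 <= g - a2 * s, 0 <= b2 * s - g, 0 <= a2 * s + (b2 - a2) * t2 - g &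
      0 <= g - (a2 * s + (b2 - a2) * (s + t2 - 1))].
Proof.
split=> [[w]|[s [/mccormick_w hw /mccormick_f hf]]];
  last by exists (a1 * a3 + D * s).
have -> : w = a1 * a3 + D * ((w - a1 * a3) / D) by field.
by move=> [/mccormick_w hw /mccormick_f hf]; exists ((w - a1 * a3) / D).
Qed.

Lemma double_mccormick2_slab : P2 `<=` slab lower upper.
Proof.
move=> [[[f x1] x2] x3] Pp.
have tE (a b x : R) : 0 < b - a -> a + (b - a) * ((x - a) / (b - a)) = x.
  by move=> /gt_eqF/negbT ?; field.
move: (Pp); have -> : (f, x1, x2, x3) = mpt ((f - a1 * a3 * x2) / D)
    ((x1 - a1) / (b1 - a1)) ((x2 - a2) / (b2 - a2)) ((x3 - a3) / (b3 - a3)).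
  by rewrite /mpt /boxpt !tE//; congr (_, _, _, _); field.
move: (_ / D) (_ / (b1 - a1)) (_ / (b2 - a2)) (_ / (b3 - a3)) => g t1 t2 t3 {Pp}.
move=> /double_mccormick2_mpt[s [[h1 h2 h3 h4] [g1 g2 g3 g4]]].
(* The box constraints are not part of the relaxation but follow from it: suitable pairs of
   McCormick inequalities add up to ga t >= 0 and ga (1 - t) >= 0 for t1 and t3, and to the same
   with b2 - a2 for t2. *)
have gaM t : 0 <= ga * t -> 0 <= t by rewrite pmulr_rge0.
have d2M t : 0 <= (b2 - a2) * t -> 0 <= t by rewrite pmulr_rge0.
exists (a1 * a3 * (a2 + (b2 - a2) * t2) + D * g), t1, t2, t3; split; first by [].
- apply/andP; split; first by apply: gaM; have := addr_ge0 h1 h2; rewrite /ga; lra.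
  by rewrite -subr_ge0; apply: gaM; have := addr_ge0 h3 h4; rewrite /ga; lra.
- apply/andP; split; first by apply: d2M; have := addr_ge0 g1 g3; lra.
  by rewrite -subr_ge0; apply: d2M; have := addr_ge0 g2 g4; lra.
- apply/andP; split; first by apply: gaM; have := addr_ge0 h1 h3; rewrite /ga; lra.
  by rewrite -subr_ge0; apply: gaM; have := addr_ge0 h2 h4; rewrite /ga; lra.
have sls : sl t1 t3 <= s.
  by rewrite /sl; case: pospP => _; move: h1 h4; rewrite /ga; lra.
have ssu : s <= su t1 t3.
  by rewrite /su; case: (leP t1 t3) => _; move: h2 h3; rewrite /ga; lra.
have a2sl := ler_wpM2l ha2 sls; have a2su := ler_wpM2l ha2 ssu.
have d2sl := ler_wpM2l (ltW d2_gt0) sls; have d2su := ler_wpM2l (ltW d2_gt0) ssu.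
rewrite lerD2l ler_pM2l// lerD2l ler_pM2l//; apply/andP; split.
  by case: pospP => _; lra.
by case: (leP (su t1 t3) t2) => _; lra.
Qed.

(** All inequalities are affine jointly in the point and [w], so the witnesses are combined with the
    same weights. *)
Lemma convex_double_mccormick2 : convex_set P2.
Proof.
apply/convex_setP => -[[[f x1] x2] x3] [[[g y1] y2] y3] t /andP[t0 t1].
have s0 : 0 <= 1 - t by rewrite subr_ge0.
have conv x y z : z = t * x + (1 - t) * y -> 0 <= x -> 0 <= y -> 0 <= z.
  by move=> -> x0 y0; rewrite addr_ge0 ?mulr_ge0.
rewrite scale4 scale4 add4.
move=> [w [[p1 p2 p3 p4] [p5 p6 p7 p8]]] [z [[q1 q2 q3 q4] [q5 q6 q7 q8]]].
exists (t * w + (1 - t) * z); split; split.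
- by apply: conv p1 q1; ring.
- by apply: conv p2 q2; ring.
- by apply: conv p3 q3; ring.
- by apply: conv p4 q4; ring.
- by apply: conv p5 q5; ring.
- by apply: conv p6 q6; ring.
- by apply: conv p7 q7; ring.
- by apply: conv p8 q8; ring.
Qed.

Let mpt_conv (t g g' x1 x2 x3 y1 y2 y3 : R) :
  t *: mpt g x1 x2 x3 + (1 - t) *: mpt g' y1 y2 y3 =
  mpt (t * g + (1 - t) * g') (t * x1 + (1 - t) * y1)
    (t * x2 + (1 - t) * y2) (t * x3 + (1 - t) * y3).
Proof. by rewrite /mpt boxpt_conv; congr boxpt; ring. Qed.

(* [s = x1 x3] is 0, [al], [be], 1 at the corners of the [(t1, t3)] square, and
   [sl], [su] interpolate linearly on the two triangles of a triangulation. *)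
Let square_corners C (u y0 y1 t1 t3 : R) : convex_set C ->
  C (mpt 0 0 y0 0) -> C (mpt (u * al) 1 (y0 + y1 * al) 0) ->
  C (mpt (u * be) 0 (y0 + y1 * be) 1) -> C (mpt u 1 (y0 + y1) 1) ->
  0 <= t1 <= 1 -> 0 <= t3 <= 1 ->
  C (mpt (u * sl t1 t3) t1 (y0 + y1 * sl t1 t3) t3) /\
  C (mpt (u * su t1 t3) t1 (y0 + y1 * su t1 t3) t3).
Proof.
move=> cC C00 C10 C01 C11 /andP[t10 t11] /andP[t30 t31].
pose pt g x1 x2 x3 : R * R * R * R :=
  (a1 * a3 * (a2 + (b2 - a2) * x2) + D * g, x1, x2, x3).
have comb := @convex_boxpt4 _ a1 b1 a2 b2 a3 b3 C.
split.
- rewrite /sl; have /orP[s|s] := le_total (t1 + t3) 1.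
    rewrite le0_posp ?subr_le0//.
    apply: (comb (1 - t1 - t3) t1 t3 0 (pt 0 0 y0 0)
      (pt (u * al) 1 (y0 + y1 * al) 0) (pt (u * be) 0 (y0 + y1 * be) 1)
      (pt u 1 (y0 + y1) 1)) => //=; try lra; by ring.
  rewrite ge0_posp ?subr_ge0//.
  apply: (comb 0 (1 - t3) (1 - t1) (t1 + t3 - 1) (pt 0 0 y0 0)
      (pt (u * al) 1 (y0 + y1 * al) 0) (pt (u * be) 0 (y0 + y1 * be) 1)
      (pt u 1 (y0 + y1) 1)) => //=; try lra; by rewrite /ga; ring.
- rewrite /su; have /orP[s|s] := le_total t1 t3.
    rewrite min_l//.
    apply: (comb (1 - t3) 0 (t3 - t1) t1 (pt 0 0 y0 0)
      (pt (u * al) 1 (y0 + y1 * al) 0) (pt (u * be) 0 (y0 + y1 * be) 1)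
      (pt u 1 (y0 + y1) 1)) => //=; try lra; by rewrite /ga; ring.
  rewrite min_r//.
  apply: (comb (1 - t1) (t1 - t3) 0 t3 (pt 0 0 y0 0)
      (pt (u * al) 1 (y0 + y1 * al) 0) (pt (u * be) 0 (y0 + y1 * be) 1)
      (pt u 1 (y0 + y1) 1)) => //=; try lra; by rewrite /ga; ring.
Qed.

Let al_le1 : al <= 1.
Proof. by move: ga_gt0 be_ge0; rewrite /ga; lra. Qed.
Let be_le1 : be <= 1.
Proof. by move: ga_gt0 al_ge0; rewrite /ga; lra. Qed.

Let v1E : v1 b1 a2 a3 = mpt (a2 * al) 1 0 0.
Proof. by rewrite /mpt /boxpt /v1 /al; congr (_, _, _, _); [field|ring..]. Qed.
Let v2E : v2 a1 a2 a3 = mpt 0 0 0 0.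
Proof. by rewrite /mpt /boxpt /v2; congr (_, _, _, _); ring. Qed.
Let v3E : v3 a1 a2 b3 = mpt (a2 * be) 0 0 1.
Proof. by rewrite /mpt /boxpt /v3 /be; congr (_, _, _, _); [field|ring..]. Qed.
Let v4E : v4 a1 b2 a3 = mpt 0 0 1 0.
Proof. by rewrite /mpt /boxpt /v4; congr (_, _, _, _); ring. Qed.
Let v5E : v5 a1 b2 b3 = mpt (b2 * be) 0 1 1.
Proof. by rewrite /mpt /boxpt /v5 /be; congr (_, _, _, _); [field|ring..]. Qed.
Let v6E : v6 b1 b2 b3 = mpt b2 1 1 1.
Proof. by rewrite /mpt /boxpt /v6 /D; congr (_, _, _, _); ring. Qed.
Let v7E : v7 b1 b2 a3 = mpt (b2 * al) 1 1 0.
Proof. by rewrite /mpt /boxpt /v7 /al; congr (_, _, _, _); [field|ring..]. Qed.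
Let v8E : v8 b1 a2 b3 = mpt a2 1 0 1.
Proof. by rewrite /mpt /boxpt /v8 /D; congr (_, _, _, _); ring. Qed.

Let Dd_neq0 : b1 * b3 - a1 * a3 != 0. Proof. exact: D_neq0. Qed.

(** The origin of the thetas: over a corner of the (t1, t3) square with normalized product s, the
    upper bound breaks at t2 = s and the lower one at t2 = 1 - s. For s = 0 and s = 1 these are
    vertices of the cube; s = [al] and s = [be] give the four additional points. *)
Let v9E : v2_9 a1 b1 a2 b2 a3 b3 = mpt (b2 * al) 1 al 0.
Proof.
rewrite /mpt /boxpt /v2_9 /theta1 /theta2 /al /D.
by congr (_, _, _, _); [field|ring|field|ring].
Qed.

Let v10E : v2_10 a1 b1 a2 b2 a3 b3 = mpt (b2 * be) 0 be 1.
Proof.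
rewrite /mpt /boxpt /v2_10 /theta3 /theta4 /be /D.
by congr (_, _, _, _); [field|ring|field|ring].
Qed.

Let v11E : v2_11 a1 b1 a2 b2 a3 b3 = mpt (a2 * be) 0 (1 - be) 1.
Proof.
rewrite /mpt /boxpt /v2_11 /theta5 /theta6 /be /D.
by congr (_, _, _, _); [field|ring|field|ring].
Qed.

Let v12E : v2_12 a1 b1 a2 b2 a3 b3 = mpt (a2 * al) 1 (1 - al) 0.
Proof.
rewrite /mpt /boxpt /v2_12 /theta7 /theta8 /al /D.
by congr (_, _, _, _); [field|ring|field|ring].
Qed.

Definition double_mccormick_vertices : set (R4 R) :=
  [set v1 b1 a2 a3; v2 a1 a2 a3; v3 a1 a2 b3; v4 a1 b2 a3;
       v5 a1 b2 b3; v6 b1 b2 b3; v7 b1 b2 a3; v8 b1 a2 b3]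
  `|` [set v2_9 a1 b1 a2 b2 a3 b3; v2_10 a1 b1 a2 b2 a3 b3;
           v2_11 a1 b1 a2 b2 a3 b3; v2_12 a1 b1 a2 b2 a3 b3].
Local Notation V := double_mccormick_vertices.

Let verticesP C : V `<=` C <->
  [/\ C (mpt 0 0 0 0), C (mpt (a2 * al) 1 0 0), C (mpt (a2 * be) 0 0 1) &
      C (mpt a2 1 0 1)] /\
  [/\ C (mpt 0 0 1 0), C (mpt (b2 * al) 1 1 0), C (mpt (b2 * be) 0 1 1) &
      C (mpt b2 1 1 1)] /\
  [/\ C (mpt (b2 * al) 1 al 0), C (mpt (b2 * be) 0 be 1),
      C (mpt (a2 * be) 0 (1 - be) 1) & C (mpt (a2 * al) 1 (1 - al) 0)].
Proof.
rewrite /V v1E v2E v3E v4E v5E v6E v7E v8E v9E v10E v11E v12E !subUset !sub1set.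
rewrite !inE. split; first by move=> [[[[[[[[? ?] ?] ?] ?] ?] ?] ?] [[[? ?] ?] ?]].
by move=> [[? ? ? ?] [[? ? ? ?] [? ? ? ?]]]; do !split.
Qed.

Lemma double_mccormick_vertices_sub : V `<=` P2.
Proof.
have d2al := mulr_ge0 (ltW d2_gt0) al_ge0; have d2be := mulr_ge0 (ltW d2_gt0) be_ge0.
have al1 : 0 <= 1 - al by rewrite subr_ge0.
have be1 : 0 <= 1 - be by rewrite subr_ge0.
have d2al1 := mulr_ge0 (ltW d2_gt0) al1; have d2be1 := mulr_ge0 (ltW d2_gt0) be1.
have := ltW ga_gt0; have := d2_gt0; rewrite /ga => d2 g0.
(* Every listed point lies over a corner of the (t1, t3) square, and the witness is the exact
   product there: 0, [al], [be] or 1. *)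
apply/verticesP; split; [|split]; split; apply/double_mccormick2_mpt; rewrite /ga;
  [exists 0|exists al|exists be|exists 1|exists 0|exists al|exists be|exists 1
  |exists al|exists be|exists be|exists al]; split; split; lra.
Qed.

(** Interpolation in two stages. Over the square, [square_corners] reaches the points of the graphs
    with t2 = 0, with t2 = 1, and on the break surfaces t2 = 1 - sl and t2 = su. Between these
    levels each graph is affine in t2. *)
Lemma double_mccormick_graphs_sub C t1 t2 t3 : convex_set C -> V `<=` C ->
  0 <= t1 <= 1 -> 0 <= t2 <= 1 -> 0 <= t3 <= 1 ->
  C (boxpt (lower t1 t2 t3) t1 t2 t3) /\ C (boxpt (upper t1 t2 t3) t1 t2 t3).
Proof.
move=> cC /verticesP[[v000 v100 v001 v101]
  [[v010 v110 v011 v111] [v9 v10 v11 v12]]].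
move=> h1 /andP[t20 t21] h3.
have [||||||l0 u0] := @square_corners C a2 0 0 t1 t3 cC; rewrite ?mul0r ?addr0//.
have [||||||lm _] := @square_corners C a2 1 (-1) t1 t3 cC;
  rewrite ?mulN1r ?subrr//.
have [||||||_ um] := @square_corners C b2 0 1 t1 t3 cC;
  rewrite ?mul1r ?add0r//.
have [||||||l1 u1] := @square_corners C b2 1 0 t1 t3 cC;
  rewrite ?mul0r ?addr0//.
move: l0 u0 lm um l1 u1; rewrite !mul0r !mul1r !mulN1r !addr0 !add0r.
move=> l0 u0 lm um l1 u1.
split.
- rewrite -[boxpt _ _ _ _]/(mpt (a2 * sl t1 t3 +
    (b2 - a2) * posp (sl t1 t3 + t2 - 1)) t1 t2 t3).
  have /orP[s|s] := le_total t2 (1 - sl t1 t3).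
    rewrite le0_posp ?mulr0 ?addr0; last by lra.
    apply: (@convex_set_segment _ _ C (fun z => mpt (a2 * sl t1 t3) t1 z t3) 0
      (1 - sl t1 t3)) => //; last by rewrite t20.
    by move=> t; rewrite mpt_conv; congr mpt; ring.
  rewrite ge0_posp; last by lra.
  apply: (@convex_set_segment _ _ C (fun z => mpt
    (a2 * sl t1 t3 + (b2 - a2) * (sl t1 t3 + z - 1)) t1 z t3)
    (1 - sl t1 t3) 1) => //.
  - by move=> t; rewrite mpt_conv; congr mpt; ring.
  - by rewrite s.
  - by move: lm; congr (C (mpt _ _ _ _)); ring.
  - by move: l1; congr (C (mpt _ _ _ _)); ring.
- rewrite -[boxpt _ _ _ _]/(mpt (a2 * su t1 t3 +
    (b2 - a2) * Num.min (su t1 t3) t2) t1 t2 t3).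
  have /orP[s|s] := le_total t2 (su t1 t3).
    rewrite min_r//.
    apply: (@convex_set_segment _ _ C (fun z => mpt
      (a2 * su t1 t3 + (b2 - a2) * z) t1 z t3) 0 (su t1 t3)).
    + exact: cC.
    + by move=> t; rewrite mpt_conv; congr mpt; ring.
    + by rewrite t20.
    + by move: u0; congr (C (mpt _ _ _ _)); ring.
    + by move: um; congr (C (mpt _ _ _ _)); ring.
  rewrite min_l//.
  apply: (@convex_set_segment _ _ C (fun z => mpt
    (a2 * su t1 t3 + (b2 - a2) * su t1 t3) t1 z t3) (su t1 t3) 1).
  + exact: cC.
  + by move=> t; rewrite mpt_conv; congr mpt; ring.
  + by rewrite s.
  + by move: um; congr (C (mpt _ _ _ _)); ring.
  + by move: u1; congr (C (mpt _ _ _ _)); ring.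
Qed.

(** The relaxation is itself a convex set containing the twelve points, so it contains the slab they
    span. *)
Lemma double_mccormick2E : P2 = slab lower upper.
Proof.
apply/seteqP; split; first exact: double_mccormick2_slab.
apply: (slab_sub_convex convex_double_mccormick2) => t1 t2 t3.
apply: double_mccormick_graphs_sub; first exact: convex_double_mccormick2.
exact: double_mccormick_vertices_sub.
Qed.

(** The McCormick bounds on x1 x3 are exact at the corners, which leaves only one admissible w
    there. *)
Let corner t1 t3 : (t1 == 0) || (t1 == 1) -> (t3 == 0) || (t3 == 1) ->
  sl t1 t3 = su t1 t3 /\ 0 <= su t1 t3 <= 1.
Proof.
move: al_ge0 be_ge0 al_le1 be_le1 => ? ? ? ?.
by move=> /orP[]/eqP-> /orP[]/eqP->; rewrite /sl /su; resolve_piecewise;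
  rewrite /ga; split; [ring|apply/andP; split; lra|ring|apply/andP; split; lra|
    ring|apply/andP; split; lra|ring|apply/andP; split; lra].
Qed.

Let extreme_vertex t1 t2 t3 g : (t1 == 0) || (t1 == 1) ->
  (t2 == 0) || (t2 == 1) -> (t3 == 0) || (t3 == 1) ->
  g = (a2 + (b2 - a2) * t2) * su t1 t3 -> slab lower upper (mpt g t1 t2 t3) ->
  extreme_points (slab lower upper) (mpt g t1 t2 t3).
Proof.
move=> h1 h2 h3 ->; have [ls /andP[s0 s1]] := corner h1 h3.
apply: extreme_slab_vertex => //; rewrite /lower /upper ?ls.
  case/orP: h2 => /eqP->; first by rewrite le0_posp; [ring|lra].
  by rewrite ge0_posp; [ring|lra].
case/orP: h2 => /eqP->; first by rewrite min_r//; ring.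
by rewrite min_l//; ring.
Qed.

(** The two tight constraints are the affine pieces whose maximum is the lower bound on this edge;
    their slopes in t2 differ by D (b2 - a2). Nothing requires the break to be interior to the edge,
    so points that coincide when a1 or a3 is 0 are covered too. *)
Let extreme_lower_edge t1 t2 t3 g : (t1 == 0) || (t1 == 1) ->
  (t3 == 0) || (t3 == 1) -> t2 = 1 - su t1 t3 -> g = a2 * su t1 t3 ->
  slab lower upper (mpt g t1 t2 t3) ->
  extreme_points (slab lower upper) (mpt g t1 t2 t3).
Proof.
move=> h1 h3 -> ->; have [ls _] := corner h1 h3; set s := su t1 t3.
pose c := a1 * a3.
apply: (@extreme_slab_edge _ _ _ _ _ _ _ hab1 hab2 hab3 _ _ _ _ _ _
  1 (- (c * a2 + D * (a2 * s))) (- (c * (b2 - a2)))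
  1 (- (c * a2 + D * (a2 * s + (b2 - a2) * (s - 1))))
  (- (c * (b2 - a2) + D * (b2 - a2)))) => //.
- move=> h x _; rewrite /lower ls -/s => /andP[+ _].
  have := ler_wpM2l (ltW (mulr_gt0 D_gt0 d2_gt0)) (posp_ge0 (s + x - 1)).
  have := ler_wpM2l (ltW (mulr_gt0 D_gt0 d2_gt0)) (posp_ge (s + x - 1)).
  by rewrite /c; split; lra.
- by rewrite /c; ring.
- by rewrite /c; ring.
- rewrite (_ : _ - _ = - (D * (b2 - a2))); last by rewrite /c; ring.
  by rewrite oppr_eq0 mulf_neq0// gt_eqF.
Qed.

Let extreme_upper_edge t1 t2 t3 g : (t1 == 0) || (t1 == 1) ->
  (t3 == 0) || (t3 == 1) -> t2 = su t1 t3 -> g = b2 * su t1 t3 ->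
  slab lower upper (mpt g t1 t2 t3) ->
  extreme_points (slab lower upper) (mpt g t1 t2 t3).
Proof.
move=> h1 h3 -> ->; set s := su t1 t3; pose c := a1 * a3.
apply: (@extreme_slab_edge _ _ _ _ _ _ _ hab1 hab2 hab3 _ _ _ _ _ _
  (-1) (c * a2 + D * (b2 * s)) (c * (b2 - a2))
  (-1) (c * a2 + D * (a2 * s)) (c * (b2 - a2) + D * (b2 - a2))) => //.
- move=> h x _; rewrite /upper -/s => /andP[_ +].
  have ms : Num.min s x <= s by rewrite ge_min lexx.
  have mx : Num.min s x <= x by rewrite ge_min lexx orbT.
  have := ler_wpM2l (ltW (mulr_gt0 D_gt0 d2_gt0)) ms.
  have := ler_wpM2l (ltW (mulr_gt0 D_gt0 d2_gt0)) mx.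
  by rewrite /c; split; lra.
- by rewrite /c; ring.
- by rewrite /c; ring.
- rewrite (_ : _ - _ = - (D * (b2 - a2))); last by rewrite /c; ring.
  by rewrite oppr_eq0 mulf_neq0// gt_eqF.
Qed.

Lemma extreme_points_double_mccormick2 : extreme_points P2 = V.
Proof.
apply/seteqP; split.
  apply: extreme_points_subset.
  - exact: convex_double_mccormick2.
  - move=> C cC VC; rewrite double_mccormick2E.
    by apply: slab_sub_convex => // t1 t2 t3; exact: double_mccormick_graphs_sub.
  - exact: double_mccormick_vertices_sub.
have /verticesP := double_mccormick_vertices_sub; rewrite double_mccormick2E.
move=> [[v000 v100 v001 v101]
  [[v010 v110 v011 v111] [v9 v10 v11 v12]]].
have su00 : su 0 0 = 0 by rewrite /su minxx; ring.
have su10 : su 1 0 = al by rewrite /su min_r//; ring.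
have su01 : su 0 1 = be by rewrite /su min_l//; ring.
have su11 : su 1 1 = 1 by rewrite /su minxx /ga; ring.
apply/verticesP; split; [|split]; split;
  [apply: extreme_vertex|apply: extreme_vertex|apply: extreme_vertex
  |apply: extreme_vertex|apply: extreme_vertex|apply: extreme_vertex
  |apply: extreme_vertex|apply: extreme_vertex
  |apply: extreme_upper_edge|apply: extreme_upper_edge
  |apply: extreme_lower_edge|apply: extreme_lower_edge];
  rewrite ?su00 ?su10 ?su01 ?su11 ?eqxx ?orbT//; ring.
Qed.

(** * The volume of the relaxation *)

Lemma double_mccormick_lower_le_upper t1 t2 t3 :
  0 <= t1 <= 1 -> 0 <= t2 <= 1 -> 0 <= t3 <= 1 -> lower t1 t2 t3 <= upper t1 t2 t3.
Proof.
move=> h1 h2 h3; have cS : convex_set (slab lower upper).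
  by rewrite -double_mccormick2E; exact: convex_double_mccormick2.
have VS : V `<=` slab lower upper.
  by rewrite -double_mccormick2E; exact: double_mccormick_vertices_sub.
have [+ _] := double_mccormick_graphs_sub cS VS h1 h2 h3.
by move=> /(slab_boxpt hab1 hab2 hab3)/andP[].
Qed.

Lemma measurable_double_mccormick_lower : measurable_fun3 lower.
Proof.
rewrite /measurable_fun3 /lower /sl.
by do ![exact: measurable_cst|apply: measurable_funD|apply: measurable_funM|
  apply: measurable_posp|apply: measurable_funB|exact: measurable_snd|
  apply: (measurableT_comp measurable_snd)|apply: (measurableT_comp measurable_fst)|
  exact: measurable_fst].
Qed.

Lemma measurable_double_mccormick_upper : measurable_fun3 upper.
Proof.
rewrite /measurable_fun3 /upper /su.
by do ![exact: measurable_cst|apply: measurable_funD|apply: measurable_funM|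
  apply: measurable_minr|apply: measurable_funB|exact: measurable_snd|
  apply: (measurableT_comp measurable_snd)|apply: (measurableT_comp measurable_fst)|
  exact: measurable_fst].
Qed.

Lemma vol4_double_mccormick2 : vol4 P2 =
  ((b1 - a1) * (b2 - a2) * (b3 - a3) *
   (b1 * (5 * b2 * b3 - a2 * b3 - b2 * a3 - 3 * a2 * a3) +
    a1 * (5 * a2 * a3 - b2 * a3 - a2 * b3 - 3 * b2 * b3)) / 24 +
   (b1 - a1) * (b2 - a2) ^+ 2 * (b3 - a3) ^+ 2 *
   (5 * (a1 * b1 * b3 - a1 * b1 * a3) + 3 * (b1 ^+ 2 * a3 - a1 ^+ 2 * b3)) /
   (24 * (b1 * b3 - a1 * a3)))%:E.
Proof.
pose d2 := b2 - a2; pose ag := al + ga.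
(* The integral in t2 is D (b2 u - a2 l - (b2 - a2)(u^2 + l^2) / 2) with l and u the bounds on s;
   the coefficients come from inserting l = al t1 + be t3 + ga y and u = ag t1 + be t3 - ga q, where
   y = posp(t1 + t3 - 1) and q = posp(t1 - t3). *)
rewrite double_mccormick2E (@vol4_slab_quad _ _ _ _ _ _ _ hab1 hab2 hab3 lower upper
  (D * d2 * be) (- (D * d2 * be ^+ 2)) (D * (b2 * ag - a2 * al))
  (- (D * d2 * be * (ag + al))) (- (D * d2 / 2 * (ag ^+ 2 + al ^+ 2)))
  (- (D * b2 * ga)) (D * d2 * ga * (ag + be))
  (D * d2 / 2 * (2 * ga * ag - ga ^+ 2))
  (- (D * (a2 * ga + d2 * ga * al))) (D * d2 * ga * (al - be))
  (- (D * d2 / 2 * (2 * ga * al + ga ^+ 2)))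
  measurable_double_mccormick_lower measurable_double_mccormick_upper
  double_mccormick_lower_le_upper).
  congr EFin; rewrite /ag /ga /d2 /al /be /D.
  by field.
move=> t1 t3 /andP[t10 t11] /andP[t30 t31].
set l := sl t1 t3; set u := su t1 t3.
have u1 : 0 <= 1 - t1 by rewrite subr_ge0.
have u3 : 0 <= 1 - t3 by rewrite subr_ge0.
have ga0 := ltW ga_gt0; have sum1 : 1 = al + be + ga by rewrite /ga; ring.
have [alt1 alu1] := conj (mulr_ge0 al_ge0 t10) (mulr_ge0 al_ge0 u1).
have [bet3 beu3] := conj (mulr_ge0 be_ge0 t30) (mulr_ge0 be_ge0 u3).
have [gat1 gau1] := conj (mulr_ge0 ga0 t10) (mulr_ge0 ga0 u1).
have [gat3 gau3] := conj (mulr_ge0 ga0 t30) (mulr_ge0 ga0 u3).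
have l01 : 0 <= l <= 1.
  rewrite /l /sl; case: pospP => h; apply/andP; split.
  - by have := mulr_ge0 ga0 h; move: ga sum1 ga0 gau1 gau3 => G; lra.
  - by move: ga sum1 ga0 gau1 gau3 => G; lra.
  - by move: ga sum1 ga0 gau1 gau3 => G; lra.
  - by move: ga sum1 ga0 gau1 gau3 => G; lra.
have u01 : 0 <= u <= 1.
  rewrite /u /su; case: (leP t1 t3) => _; apply/andP; split;
    move: ga sum1 ga0 gat1 gau1 gat3 gau3 => G; lra.
have [/andP[l0 l1] /andP[u0 u1']] := conj l01 u01.
apply: integral01_eq (integral01D (integral01D
    (integral01Z (D * (b2 * u - a2 * l)) (integral01X 0))
    (integral01Z (- (D * d2)) (integral01_pospB 0 u)))
    (integral01Z (- (D * d2)) (integral01_pospD 0 (l - 1)))) _ _.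
  move=> t2 _; rewrite /lower /upper -/l -/u min_posp.
  rewrite (_ : l + t2 - 1 = t2 + (l - 1)); last by ring.
  by rewrite /d2 !expr1 expr0; ring.
rewrite (_ : 1 + (l - 1) = l); last by ring.
rewrite (ge0_posp l0) (ge0_posp u0).
rewrite (@le0_posp _ (l - 1)) ?subr_le0// (@le0_posp _ (u - 1)) ?subr_le0//.
rewrite /l /u /sl /su min_posp /ag /d2.
(* These relations trade the products q t1 and y t1 for q^2, y^2 and terms with t3, matching the
   shape without mixed terms in t1. They are all that is kept of the positive parts. *)
have [q0 y0] : posp (t1 - t3) * (t1 - t3 - posp (t1 - t3)) = 0 /\
    posp (t1 + t3 - 1) * (t1 + t3 - 1 - posp (t1 + t3 - 1)) = 0.
  by split; case: pospP; rewrite ?subrr ?mulr0 ?mul0r.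
move: (posp (t1 - t3)) (posp (t1 + t3 - 1)) q0 y0 => q y q0 y0.
apply/eqP; rewrite -subr_eq0; apply/eqP.
transitivity (D * (b2 - a2) * ga * ((al + ga) * (q * (t1 - t3 - q)) -
  al * (y * (t1 + t3 - 1 - y)))); last by rewrite q0 y0 !mulr0 subrr mulr0.
by field.
Qed.

End DoubleMcCormick.

Theorem theorem4p3 (R : realType) (a1 b1 a2 b2 a3 b3 : R)
    (ha1 : 0 <= a1) (hab1 : a1 < b1)
    (ha2 : 0 <= a2) (hab2 : a2 < b2)
    (ha3 : 0 <= a3) (hab3 : a3 < b3)
    (hord1 : a1 * b2 * b3 + b1 * a2 * a3 <= b1 * a2 * b3 + a1 * b2 * a3)
    (hord2 : b1 * a2 * b3 + a1 * b2 * a3 <= b1 * b2 * a3 + a1 * a2 * b3) :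
  extreme_points (double_mccormick2 a1 b1 a2 b2 a3 b3) =
    [set v1 b1 a2 a3; v2 a1 a2 a3; v3 a1 a2 b3; v4 a1 b2 a3;
         v5 a1 b2 b3; v6 b1 b2 b3; v7 b1 b2 a3; v8 b1 a2 b3]
    `|` [set v2_9 a1 b1 a2 b2 a3 b3; v2_10 a1 b1 a2 b2 a3 b3;
             v2_11 a1 b1 a2 b2 a3 b3; v2_12 a1 b1 a2 b2 a3 b3]
  /\
  vol4 (double_mccormick2 a1 b1 a2 b2 a3 b3) =
    (vol4 (trilinear_hull a1 b1 a2 b2 a3 b3) +
     ((b1 - a1) * (b2 - a2) ^+ 2 * (b3 - a3) ^+ 2 *
      (5 * (a1 * b1 * b3 - a1 * b1 * a3) +
       3 * (b1 ^+ 2 * a3 - a1 ^+ 2 * b3)) /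
      (24 * (b1 * b3 - a1 * a3)))%:E)%E.
Proof.
split; first exact: extreme_points_double_mccormick2.
by rewrite vol4_double_mccormick2// vol4_trilinear_hull// EFinD.
Qed.
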